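(* Let $\mathcal{G}=(\mathcal{V},\mathcal{E})$ be a $\mathbb{Z}^d$-periodic graph with quotient graph $\mathcal{G}_*=(\mathcal{V}_*,\mathcal{E}_* )$, let $Q:\mathcal{V}\to\mathbb{R}$ be a $\mathbb{Z}^d$-periodic potential, and let $\mu>0$ be a coupling constant. Then, in the limit $\mu\to\infty$ (with $\mathcal{G}$ and $Q$ fixed), the Lebesgue measure of the spectrum of the Schrödinger operator $H_{\mu Q}=\Delta+\mu Q$ on $\ell^2(\mathcal{V})$ satisfies $$|\sigma(H_{\mu Q})|=O(\mu^{-\omega}),$$ where $$\omega=\min_{a\in Q(\mathcal{V}_* )}\omega(a),\qquad \omega(a)=\min_{\mathbf{c}\in\mathcal{C}^+}\ \max_{\mathbf{e}\in\mathbf{c}}\ \omega_a(\mathbf{e}).$$ Here $\mathcal{C}^+$ is the set of all homotopically nontrivial cycles in $\mathcal{G}_*$, the maximum is taken over all edges $\mathbf{e}$ of the cycle $\mathbf{c}$, and $\omega_a(\mathbf{e})$ is the weight $$\omega_a(\mathbf{e})=d(u,\mathcal{V}_*^a)+d(v,\mathcal{V}_*^a),\qquad \mathbf{e}=\{u,v\}\in\mathcal{E}_*,$$ with $\mathcal{V}_*^a=\{v\in\mathcal{V}_*: Q(v)=a\}$.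
   Context: Periodic graphs. $\mathcal{G}=(\mathcal{V},\mathcal{E})$ is a simple (no loops, no multiple edges), connected, infinite, locally finite graph with unoriented edge set $\mathcal{E}$; $\mathcal{A}$ denotes the set of oriented edges (each edge of $\mathcal{E}$ is taken with both orientations), and an oriented edge from $u$ to $v$ is written $(u,v)$. $\mathcal{G}$ is $\mathbb{Z}^d$-periodic: it carries a free action of the group $\mathbb{Z}^d$ by graph automorphisms with finite quotient graph $\mathcal{G}_*=\mathcal{G}/\mathbb{Z}^d=(\mathcal{V}_*,\mathcal{E}_* )$, where $\mathcal{V}_*=\mathcal{V}/\mathbb{Z}^d$, $\mathcal{E}_*=\mathcal{E}/\mathbb{Z}^d$, $\mathcal{A}_*=\mathcal{A}/\mathbb{Z}^d$. It is assumed that $\mathcal{G}_*$ has no loops and no multiple edges. The graph $\mathcal{G}$ is regarded as embedded in $\mathbb{R}^d$ so that the action of $\mathrm{n}\in\mathbb{Z}^d$ is the translation $v\mapsto v+\mathrm{n}$; then $\mathcal{G}_*$ is a graph on the torus $\mathbb{R}^d/\mathbb{Z}^d$. Indices. Each $v\in\mathcal{V}$ is written uniquely as $v=v_0+[v]$ with $v_0\in\mathcal{V}\cap[0,1)^d$ and $[v]\in\mathbb{Z}^d$. The index of an oriented edge $\mathbf{e}=(u,v)\in\mathcal{A}$ is $\tau(\mathbf{e})=[v]-[u]\in\mathbb{Z}^d$; it is invariant under the $\mathbb{Z}^d$-action, so it defines an index $\tau(\mathbf{e}_* )\in\mathbb{Z}^d$ for each $\mathbf{e}_*\in\mathcal{A}_*$.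 Cycles. A path of length $l$ is a sequence of oriented edges $(\mathbf{e}_1,\dots,\mathbf{e}_l)$ with $\mathbf{e}_j=(v_{j-1},v_j)$; it is closed if $v_0=v_l$. A cycle is a closed path of length $l\ge 3$ with distinct intermediate vertices. The index of a path (in particular of a cycle) in $\mathcal{G}_*$ is $\tau(\mathbf{e}_1)+\dots+\tau(\mathbf{e}_l)$. A cycle in $\mathcal{G}_*$ is homotopically nontrivial if its index is non-zero (equivalently, it corresponds to a path in $\mathcal{G}$ from some $v$ to $v+\mathrm{n}$ with $\mathrm{n}\ne 0$; this does not depend on the embedding). The set $\mathcal{C}^+$ is finite up to trivial repetition and non-empty. Distances. For $u,v\in\mathcal{V}_*$, $d(u,v)$ is the minimal number of edges of a path from $u$ to $v$ in $\mathcal{G}_*$, and for $a\in Q(\mathcal{V}_* )$, $d(u,\mathcal{V}_*^a)=\min_{v\in\mathcal{V}_*^a}d(u,v)$ (which is $0$ if $u\in\mathcal{V}_*^a$). Operators. $\ell^2(\mathcal{V})$ is the Hilbert space of square summable functions $f:\mathcal{V}\to\mathbb{C}$. The adjacency operator is $(\Delta f)(v)=\sum_{u\sim v}f(u)$, the sum being over vertices $u$ adjacent to $v$ in $\mathcal{G}$. A potential $Q:\mathcal{V}\to\mathbb{R}$ is $\mathbb{Z}^d$-periodic if $Q(v+\mathrm{n})=Q(v)$ for all $v\in\mathcal{V}$, $\mathrm{n}\in\mathbb{Z}^d$; it acts by multiplication $(Qf)(v)=Q(v)f(v)$ and is identified with a function on $\mathcal{V}_*$. $\sigma(\cdot)$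 denotes the spectrum and $|\cdot|$ the Lebesgue measure on $\mathbb{R}$. *)

(* Defs.v *)
From HB Require Import structures.
From mathcomp Require Import all_boot all_order all_algebra.
From mathcomp Require Import generic_quotient.
From mathcomp Require Import complex.
From mathcomp Require Import all_classical all_reals all_analysis.

Set Implicit Arguments.
Unset Strict Implicit.
Unset Printing Implicit Defensive.

Import Order.TTheory GRing.Theory Num.Theory.
Local Open Scope classical_set_scope.
Local Open Scope ring_scope.
Local Open Scope complex_scope.
Local Open Scope quotient_scope.

(* Junk value 0 on the empty set. *)
Definition nat_min (S : set nat) : nat :=
  if pselect (exists n, `[< S n >]) is left h then ex_minn h else 0%N.

Lemma nat_minP (S : set nat) : S !=set0 ->
  S (nat_min S) /\ forall k, S k -> (nat_min S <= k)%N.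
Proof.
move=> [n Sn]; rewrite /nat_min; case: pselect => [h|]; last first.
  by case; exists n; apply/asboolP.
by case: ex_minnP => m /asboolP Sm mmin; split=> // k Sk; apply/mmin/asboolP.
Qed.

(* The vertices are the points [position v] of R^d; the finiteness and
   simplicity conditions on the graph and on its quotient are in
   [periodic_graph] below. *)
Record zd_graph (R : realType) (d : nat) := ZdGraph {
  vertex :> choiceType;
  adj : rel vertex;
  adj_sym : symmetric adj;
  adj_irr : irreflexive adj;
  shift : 'rV[int]_d -> vertex -> vertex;
  shift0 : forall v, shift 0 v = v;
  shiftD : forall m n v, shift (m + n) v = shift m (shift n v);
  shift_adj : forall n u v, adj (shift n u) (shift n v) = adj u v;
  shift_free : forall n v, shift n v = v -> n = 0;
  position : vertex -> 'rV[R]_d;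
  position_inj : injective position;
  position_shift : forall n v,
    position (shift n v) = position v + map_mx (fun z : int => z%:~R) n
}.
Arguments adj {R d z}.
Arguments shift {R d z}.
Arguments position {R d z}.

Section PeriodicGraph.
Context {R : realType} {d : nat} (G : zd_graph R d).
Implicit Types (u v : G) (n : 'rV[int]_d).

Definition arc : choiceType := {p : G * G | adj p.1 p.2}.
Definition arc_src (e : arc) : G := (val e).1.
Definition arc_tgt (e : arc) : G := (val e).2.

Definition same_orbit u v : bool := `[< exists n, shift n u = v >].
Definition arc_same_orbit (e f : arc) : bool :=
  `[< exists n, shift n (arc_src e) = arc_src f /\
                shift n (arc_tgt e) = arc_tgt f >].

Lemma shiftNK n u : shift (- n) (shift n u) = u.
Proof. by rewrite -shiftD addNr shift0. Qed.

Lemma same_orbit_refl : reflexive same_orbit.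
Proof. by move=> u; apply/asboolP; exists 0; rewrite shift0. Qed.

Lemma same_orbit_sym : symmetric same_orbit.
Proof.
have H u v : same_orbit u v -> same_orbit v u.
  by move=> /asboolP[n <-]; apply/asboolP; exists (- n); rewrite shiftNK.
by move=> u v; apply/idP/idP; exact: H.
Qed.

Lemma same_orbit_trans : transitive same_orbit.
Proof.
move=> v u w /asboolP[m <-] /asboolP[n <-]; apply/asboolP.
by exists (n + m); rewrite shiftD.
Qed.

Lemma arc_same_orbit_refl : reflexive arc_same_orbit.
Proof. by move=> e; apply/asboolP; exists 0; rewrite !shift0. Qed.

Lemma arc_same_orbit_sym : symmetric arc_same_orbit.
Proof.
have H e f : arc_same_orbit e f -> arc_same_orbit f e.
  move=> /asboolP[n [es et]]; apply/asboolP.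
  by exists (- n); rewrite -es -et !shiftNK.
by move=> e f; apply/idP/idP; exact: H.
Qed.

Lemma arc_same_orbit_trans : transitive arc_same_orbit.
Proof.
move=> f e g /asboolP[m [mes met]] /asboolP[n [nfs nft]]; apply/asboolP.
by exists (n + m); rewrite !shiftD mes met.
Qed.

Canonical same_orbit_equiv :=
  EquivRel same_orbit same_orbit_refl same_orbit_sym same_orbit_trans.
Canonical arc_same_orbit_equiv :=
  EquivRel arc_same_orbit
    arc_same_orbit_refl arc_same_orbit_sym arc_same_orbit_trans.

Definition qvertex := {eq_quot same_orbit_equiv}.
Definition qarc := {eq_quot arc_same_orbit_equiv}.

Definition qsrc (e : qarc) : qvertex := \pi_qvertex (arc_src (repr e)).
Definition qtgt (e : qarc) : qvertex := \pi_qvertex (arc_tgt (repr e)).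

(* [v], the integer part of v *)
Definition cell v : 'rV[int]_d := map_mx Num.floor (position v).
Definition arc_index (e : arc) : 'rV[int]_d :=
  cell (arc_tgt e) - cell (arc_src e).
Definition qarc_index (e : qarc) : 'rV[int]_d := arc_index (repr e).

Lemma cell_shift n v : cell (shift n v) = cell v + n.
Proof.
apply/rowP => j; rewrite /cell position_shift !mxE.
by rewrite floorDrz ?intr_int// intrKfloor.
Qed.

Lemma repr_arc (e : arc) : arc_same_orbit (repr (\pi_qarc e)) e.
Proof. by have /eqmodP := reprK (\pi_qarc e). Qed.

Lemma qsrc_pi (e : arc) : qsrc (\pi_qarc e) = \pi_qvertex (arc_src e).
Proof.
have /asboolP[n [es _]] := repr_arc e.
by apply/eqmodP/asboolP; exists n.
Qed.

Lemma qtgt_pi (e : arc) : qtgt (\pi_qarc e) = \pi_qvertex (arc_tgt e).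
Proof.
have /asboolP[n [_ et]] := repr_arc e.
by apply/eqmodP/asboolP; exists n.
Qed.

Lemma qarc_index_pi (e : arc) : qarc_index (\pi_qarc e) = arc_index e.
Proof.
have /asboolP[n [es et]] := repr_arc e.
by rewrite /qarc_index /arc_index -es -et !cell_shift [cell (arc_src _) + n]addrC addrKA.
Qed.

Record periodic_graph : Prop := PeriodicGraph {
  graph_connected : forall u v, exists2 p : seq G, path adj u p & last u p = v;
  graph_infinite : infinite_set [set: G];
  graph_locally_finite : forall v, finite_set [set u | adj v u];
  quotient_vertices_finite : finite_set [set: qvertex];
  quotient_arcs_finite : finite_set [set: qarc];
  quotient_no_loop : forall e : qarc, qsrc e <> qtgt e;
  quotient_no_multiple : forall e f : qarc,
    qsrc e = qsrc f -> qtgt e = qtgt f -> e = f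
}.

Fixpoint qpath (x : qvertex) (p : seq qarc) (y : qvertex) : bool :=
  if p is e :: p' then (qsrc e == x) && qpath (qtgt e) p' y else x == y.

(* For a closed path, the list of sources is v_0, ..., v_{l-1}. *)
Definition qcycle (c : seq qarc) : Prop :=
  [/\ (3 <= size c)%N, exists x, qpath x c x & uniq (map qsrc c)].

Definition qpath_index (p : seq qarc) : 'rV[int]_d :=
  \sum_(e <- p) qarc_index e.

Definition nontrivial_cycles : set (seq qarc) :=
  [set c | qcycle c /\ qpath_index c <> 0].

Definition qdist (x y : qvertex) : nat :=
  nat_min [set size p | p in [set p | qpath x p y]].

Definition periodic_potential (Q : G -> R) : Prop :=
  forall n v, Q (shift n v) = Q v.

Section Weights.
Variable Q : G -> R.

(* The function on the quotient induced by a periodic Q. *)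
Definition qpotential (x : qvertex) : R := Q (repr x).

Lemma qpotential_pi v : periodic_potential Q ->
  qpotential (\pi_qvertex v) = Q v.
Proof.
move=> perQ; have : same_orbit (repr (\pi_qvertex v)) v.
  by have /eqmodP := reprK (\pi_qvertex v).
by move=> /asboolP[n nv]; rewrite -[in RHS]nv perQ.
Qed.

Definition qlevel (a : R) : set qvertex := [set x | qpotential x = a].

Definition dist_level (a : R) (x : qvertex) : nat :=
  nat_min [set qdist x y | y in qlevel a].

Definition edge_weight (a : R) (e : qarc) : nat :=
  (dist_level a (qsrc e) + dist_level a (qtgt e))%N.

Definition omega_level (a : R) : nat :=
  nat_min [set (\max_(e <- c) edge_weight a e)%N | c in nontrivial_cycles].

Definition omega : nat := nat_min [set omega_level a | a in range qpotential].

End Weights.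

Definition adjacency (f : G -> R[i]) : G -> R[i] :=
  fun v => \sum_(u \in [set u | adj v u]) f u.

Definition schrodinger (Q : G -> R) (f : G -> R[i]) : G -> R[i] :=
  fun v => adjacency f v + (Q v)%:C * f v.

End PeriodicGraph.

Section Spectrum.
Context {R : realType} {V : choiceType}.
Implicit Types (f g : V -> R[i]) (T S : (V -> R[i]) -> (V -> R[i])).

Definition l2_sum f : \bar R := \esum_(v in [set: V]) ((Normc.normc (f v)) ^+ 2)%:E.

Definition l2 : set (V -> R[i]) := [set f | (l2_sum f < +oo)%E].

Definition l2_norm f : R := Num.sqrt (fine (l2_sum f)).

(* Operators act on all functions V -> C, but only their values on l2 matter. *)
Definition bounded_operator T : Prop :=
  [/\ forall f, l2 f -> l2 (T f),
      forall (z : R[i]) f g, l2 f -> l2 g ->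
        T (fun v => z * f v + g v) = (fun v => z * T f v + T g v) &
      exists M : R, forall f, l2 f -> l2_norm (T f) <= M * l2_norm f].

Definition resolvent_set T : set R[i] :=
  [set z | exists S, bounded_operator S /\
     forall f, l2 f ->
       S (fun v => T f v - z * f v) = f /\
       (fun v => T (S f) v - z * S f v) = f].

Definition spectrum T : set R[i] := ~` resolvent_set T.

(* For a self-adjoint operator the spectrum is real and this is all of it. *)
Definition real_spectrum T : set R := [set x | spectrum T x%:C].

End Spectrum.

(* Main.v *)
From mathcomp Require Import all_boot all_order all_algebra.
From mathcomp Require Import generic_quotient complex ring lra.
From mathcomp Require Import all_classical all_reals all_analysis.
Require Import Defs.
Import Order.TTheory GRing.Theory Num.Theory.
Import numFieldNormedType.Exports.

Set Implicit Arguments.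
Unset Strict Implicit.
Unset Printing Implicit Defensive.

Local Open Scope classical_set_scope.
Local Open Scope ring_scope.
Local Open Scope complex_scope.
Local Open Scope quotient_scope.

(* Fix a value a of Q and delete the arcs of weight omega_a >= omega(a).  What
   remains of the quotient contains no homotopically nontrivial cycle, so the
   indices of the remaining arcs are differences of a function phi on the
   quotient vertices.  Shifting the fundamental domain by phi, the operator H0
   without the deleted edges becomes one and the same N x N symmetric matrix on
   every copy of the fundamental domain, and has at most N eigenvalues.

   Let lam be close to mu a, at distance at least K mu^-omega(a) from these
   eigenvalues.  Off the level set of a the diagonal of H0 - lam is of order mu,
   so the entries of R0 = (H0 - lam)^-1 decay:
     |R0(x, y)| <= C (mu^(-d(x) - d(y)) mu^omega(a) / K + 1 / mu),
   d being the distance to the level set.  For the weight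
   w = min(mu^d, s mu^((omega(a) + 1) / 2)), with s small and then K large, the
   operator R0 P, where P is the adjacency operator of the deleted edges, is a
   contraction of the space l2 with weight w: an entry of w R0 w is at most a
   small multiple of s mu^omega(a), and w(x) w(y) >= s mu^omega(a) for every
   deleted edge.  Hence x = R0 f - R0 P x is uniquely solvable and lam is not in
   the spectrum.  If lam is far from every mu a, deleting all the edges gives the
   same conclusion.  So the spectrum is covered by N^2 intervals of length
   O(mu^-omega). *)

(** * Resolvents of symmetric matrices *)

Lemma similar_diag_resolvent (F : fieldType) N (P : 'M[F]_N) (D D' : 'rV[F]_N)
    (l : F) : P \in unitmx -> (forall k, (D 0 k - l) * D' 0 k = 1) ->
  (invmx P *m diag_mx D *m P - l%:M) *m (invmx P *m diag_mx D' *m P) = 1%:M.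
Proof.
move=> uP DD'.
have -> : invmx P *m diag_mx D *m P - l%:M
    = invmx P *m diag_mx (D - const_mx l) *m P.
  rewrite raddfB/= mulmxBr mulmxBl diag_const_mx scalar_mxC.
  by rewrite -[_%:M *m _ *m _]mulmxA mulVmx// mulmx1.
rewrite !mulmxA mulmxK// -[_ *m diag_mx _ *m diag_mx _]mulmxA mulmx_diag.
rewrite (_ : diag_mx _ = 1%:M) ?mulmx1 ?mulVmx// -diag_const_mx; congr diag_mx.
by apply/rowP => k; rewrite !mxE DD'.
Qed.

Lemma mulmx1_invmx (F : fieldType) N (X Y : 'M[F]_N) : X *m Y = 1%:M ->
  X \in unitmx /\ invmx X = Y.
Proof.
move=> XY; have [uX _] := mulmx1_unit XY.
by split=> //; rewrite -[LHS]mulmx1 -XY mulKmx.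
Qed.

Section SymmetricResolvent.
Variables (R : realType) (N : nat).

Lemma unitarymx_entry_le1 (P : 'M[R[i]]_N) k i :
  P \is unitarymx -> `|P k i| <= 1.
Proof.
move=> /unitarymxP /matrixP /(_ k k); rewrite !mxE eqxx mulr1n => PP.
rewrite -(@expr_le1 _ 2)// -PP (bigD1 i)//= !mxE -normCK lerDl.
by apply: sumr_ge0 => j _; rewrite !mxE -normCK exprn_ge0.
Qed.

(** Unitary diagonalization over [R[i]]: each entry of the resolvent is a sum of [N] products of two
    numbers of modulus at most 1 and one factor [(ev k - lam)^-1]. The points [ev] are fixed before
    [lam] and [eps], so that they can serve as centers of covering intervals. *)
Lemma sym_resolvent_bound (A : 'M[R]_N) : A^T = A ->
  exists ev : 'I_N -> R, forall (lam eps : R), 0 < eps ->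
    (forall k, eps <= `|ev k - lam|) ->
    (A - lam%:M) \in unitmx /\
    forall i j, `|invmx (A - lam%:M) i j| <= N%:R / eps.
Proof.
move=> symA.
pose toC := map_mx (real_complex R) : 'M[R]_N -> 'M[R[i]]_N.
have herm : toC A \is hermsymmx.
  apply: realsym_hermsym.
    apply/is_hermitianmxP.
    by rewrite expr0 scale1r map_mx_id// /toC map_trmx symA.
  by apply/mxOverP => i j; rewrite mxE; apply/complex_realP; eexists.
have := @orthomx_spectralP _ _ (toC A).
set P := spectralmx _; set D := spectral_diag _ => /elimT /(_ _) sp.
have {}sp : toC A = invmx P *m diag_mx D *m P.
  exact/sp/hermitian_normalmx.
have uP : P \is unitarymx by exact: spectral_unitarymx.
have uP' := unitarymx_unit uP.
have /mxOverP Dr := hermitian_spectral_diag_real herm.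
pose ev k := complex.Re (D 0 k).
have evE k : D 0 k = (ev k)%:C by rewrite RRe_real//; exact: Dr.
exists ev => lam eps eps0 far.
have far0 k : ev k - lam != 0.
  by rewrite -normr_gt0; apply: lt_le_trans (far k).
pose D' : 'rV[R[i]]_N := \row_k (ev k - lam)%:C^-1.
have DD' k : (D 0 k - lam%:C) * D' 0 k = 1.
  rewrite mxE evE -rmorphB divff//.
  by rewrite -(rmorph0 (real_complex R)) (inj_eq (@complexI _)).
have [] := mulmx1_invmx (similar_diag_resolvent uP' DD').
have <- : toC (A - lam%:M) = invmx P *m diag_mx D *m P - lam%:C%:M.
  by rewrite -sp /toC map_mxB map_scalar_mx.
set B := _ *m P => uA BE.
have uAR : (A - lam%:M) \in unitmx by rewrite -(map_unitmx (real_complex R)).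
split=> // i j.
have {}BE : toC (invmx (A - lam%:M)) = B by rewrite -BE; exact: map_invmx.
have -> : `|invmx (A - lam%:M) i j|%R = complex.Re `|B i j|.
  by rewrite -BE mxE normc_def/= expr0n addr0 sqrtr_sqr.
suff : `|B i j| <= (N%:R / eps)%:C by rewrite lecE/= => /andP[].
rewrite /B invmx_unitary// mul_mx_diag !mxE.
apply: le_trans (ler_norm_sum _ _ _) _.
have -> : (N%:R / eps)%:C = \sum_(k < N) (eps^-1)%:C.
  by rewrite sumr_const card_ord -rmorphMn/= mulr_natl.
apply: ler_sum => k _; rewrite !mxE !normrM norm_conjC.
apply: (@le_trans _ _ (1 * (eps^-1)%:C * 1)); last by rewrite mul1r mulr1.
apply: ler_pM; rewrite ?mulr_ge0 ?normr_ge0 ?unitarymx_entry_le1//.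
apply: ler_pM; rewrite ?normr_ge0 ?unitarymx_entry_le1//.
rewrite -fmorphV normc_def/= expr0n addr0 sqrtr_sqr lecR normfV.
by rewrite lef_pV2 ?posrE// normr_gt0.
Qed.

End SymmetricResolvent.

(** * Decay of the entries of an inverse matrix away from a level set *)

Section ResolventDecay.
Variables (R : realFieldType) (N : nat).
Implicit Types (M : 'M[R]_N) (x : 'I_N -> R) (dist : 'I_N -> nat).

(** In row [i] the diagonal entry dominates, so [kap * |x i|] is at most 1 plus the values at the
    neighbors, whose distance is at least [dist i - 1]. Each step away from the level set thus gains
    a factor [N / kap]. *)
Lemma column_decay M x dist (kap X : R) :
  (forall i, (0 < dist i)%N -> kap <= `|M i i|) ->
  (forall i j, i != j -> `|M i j| <= 1) ->
  (forall i j, i != j -> M i j != 0 -> (dist i <= (dist j).+1)%N) ->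
  (forall i, `|\sum_j M i j * x j| <= 1) ->
  (forall i, `|x i| <= X) -> 0 < kap -> 2 * N%:R <= kap ->
  forall i, `|x i| <= (N%:R / kap) ^+ dist i * X + 2 / kap.
Proof.
move=> diagM offM lipM solx bndx kap0 kapN.
(* The induction on [k] treats all [i] at distance at least [k] at once, since its step uses the
   neighbors of [i]. *)
suff H k i : (k <= dist i)%N -> `|x i| <= (N%:R / kap) ^+ k * X + 2 / kap.
  by move=> i; exact: H.
have q0 : 0 <= N%:R / kap by rewrite divr_ge0// ltW.
have q1 : N%:R / kap <= 2^-1 by rewrite ler_pdivrMr// ler_pdivlMl.
elim: k i => [|k IHk] i ki.
  by rewrite expr0 mul1r (le_trans (bndx i))// lerDl divr_ge0// ltW.
set Bk := (N%:R / kap) ^+ k * X + 2 / kap in IHk.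
have Bk0 : 0 <= Bk.
  rewrite addr_ge0 ?mulr_ge0 ?exprn_ge0 ?divr_ge0// ?invr_ge0 ?(ltW kap0)//.
  exact: le_trans (bndx i).
have offsum : `|\sum_(j | j != i) M i j * x j| <= N%:R * Bk.
  apply: le_trans (ler_norm_sum _ _ _) _.
  apply: (@le_trans _ _ (\sum_(j < N) Bk)); last first.
    by rewrite sumr_const card_ord mulr_natl.
  rewrite [leRHS](bigID (fun j => j != i))/= -[leLHS]addr0; apply: lerD.
    apply: ler_sum => j ji; rewrite normrM.
    have [->|Mij] := eqVneq (M i j) 0; first by rewrite normr0 mul0r.
    rewrite -[leRHS]mul1r ler_pM ?offM// 1?eq_sym//.
    by apply: IHk; rewrite -ltnS (leq_trans ki)// lipM// eq_sym.
  exact: sumr_ge0.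
have main : kap * `|x i| <= 1 + N%:R * Bk.
  apply: (@le_trans _ _ `|M i i * x i|).
    by rewrite normrM ler_wpM2r// diagM// (leq_ltn_trans _ ki).
  have -> : M i i * x i = \sum_j M i j * x j - \sum_(j | j != i) M i j * x j.
    by rewrite [X in X - _](bigD1 i)//= addrK.
  by apply: le_trans (ler_normB _ _) _; rewrite lerD.
(* The additive error stays below [2 / kap]: the new error [1 / kap + (N / kap) * (2 / kap)] leaves
   the last summand as slack, nonnegative because [2 * N <= kap]. *)
have -> : (N%:R / kap) ^+ k.+1 * X + 2 / kap
    = 1 / kap + (N%:R / kap) * Bk + (1 - 2 * (N%:R / kap)) / kap.
  by rewrite /Bk exprS; field; rewrite gt_eqF.
apply: (@le_trans _ _ (1 / kap + N%:R / kap * Bk)); last first.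
  rewrite lerDl divr_ge0 ?(ltW kap0)// subr_ge0; lra.
have -> : 1 / kap + N%:R / kap * Bk = (1 + N%:R * Bk) / kap.
  by field; rewrite gt_eqF.
by rewrite ler_pdivlMr// mulrC.
Qed.

(** Column decay is used twice. By symmetry its first use gives decay in the column index; this
    bound then replaces [X] in the second use, and the errors add up to at most [4 / kap]. *)
Lemma inverse_entry_decay M r dist (kap X : R) :
  M *m r = 1%:M -> r^T = r ->
  (forall i, (0 < dist i)%N -> kap <= `|M i i|) ->
  (forall i j, i != j -> `|M i j| <= 1) ->
  (forall i j, i != j -> M i j != 0 -> (dist i <= (dist j).+1)%N) ->
  (forall i j, `|r i j| <= X) -> 0 < kap -> 2 * N%:R <= kap ->
  forall i j,
    `|r i j| <= (N%:R / kap) ^+ (dist i + dist j) * X + 4 / kap.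
Proof.
move=> Mr symr diagM offM lipM bndr kap0 kapN i j.
have symrE k l : r k l = r l k by rewrite -[in LHS]symr mxE.
have solve l k : `|\sum_m M k m * r m l| <= 1.
  have /matrixP/(_ k l) := Mr; rewrite !mxE => ->.
  by case: eqP => _; rewrite ?normr1 ?normr0.
have q0 : 0 <= N%:R / kap by rewrite divr_ge0// ltW.
have q1 : N%:R / kap <= 1 by rewrite ler_pdivrMr// mul1r; have := ler0n R N; lra.
have colj k : `|r k j| <= (N%:R / kap) ^+ dist j * X + 2 / kap.
  rewrite symrE.
  exact: (@column_decay M (fun m => r m k) dist kap X).
have := @column_decay M (fun m => r m j) dist kap _ diagM offM lipM
  (solve j) colj kap0 kapN i.
move=> /le_trans; apply; rewrite exprD mulrDr mulrA -addrA lerD2l.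
have -> : 4 / kap = 1 * (2 / kap) + 2 / kap by ring.
by rewrite lerD2r ler_wpM2r ?divr_ge0 ?(ltW kap0)// exprn_ile1.
Qed.

(** The two upper bounds on [w] serve the two terms of the decay estimate: the powers [mu ^+ dist]
    cancel the decaying term down to powers of [N / c], and [B] controls the constant term. *)
Lemma weighted_inverse_entry M r dist (w : 'I_N -> R) (mu c X B L : R) D :
  M *m r = 1%:M -> r^T = r ->
  (forall i, (0 < dist i)%N -> c * mu <= `|M i i|) ->
  (forall i j, i != j -> `|M i j| <= 1) ->
  (forall i j, i != j -> M i j != 0 -> (dist i <= (dist j).+1)%N) ->
  (forall i j, `|r i j| <= X) -> 0 < mu -> 0 < c -> 2 * N%:R <= c * mu ->
  (forall i, 0 <= w i) -> (forall i, w i <= mu ^+ dist i) ->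
  (forall i, w i <= B) -> (forall i, dist i <= D)%N ->
  1 <= L -> N%:R / c <= L ->
  forall i j, w i * `|r i j| * w j <= L ^+ (D + D) * X + 4 * B ^+ 2 / (c * mu).
Proof.
move=> Mr symr diagM offM lipM bndr mu0 c0 muN w0 wmu wB dD L1 LN i j.
have X0 : 0 <= X by exact: le_trans (bndr i i).
have cmu0 : 0 < c * mu by rewrite mulr_gt0.
have B0 : 0 <= B by exact: le_trans (wB i).
have := inverse_entry_decay Mr symr diagM offM lipM bndr cmu0 muN i j.
move=> rij; rewrite mulrAC.
apply: (le_trans (ler_wpM2l (mulr_ge0 (w0 i) (w0 j)) rij)).
rewrite mulrDr; apply: lerD.
  apply: (@le_trans _ _ ((mu ^+ dist i * mu ^+ dist j)
                          * ((N%:R / (c * mu)) ^+ (dist i + dist j) * X))).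
    rewrite ler_wpM2r//.
      by rewrite mulr_ge0// exprn_ge0// divr_ge0// ltW.
    by rewrite ler_pM.
  rewrite -exprD mulrA -exprMn ler_wpM2r//.
  have -> : mu * (N%:R / (c * mu)) = N%:R / c by field; rewrite !gt_eqF.
  apply: (@le_trans _ _ (L ^+ (dist i + dist j))).
    by rewrite lerXn2r ?nnegrE ?divr_ge0 ?(ltW c0)// (le_trans _ L1).
  by rewrite ler_weXn2l// leq_add.
have -> : 4 * B ^+ 2 / (c * mu) = B * B * (4 / (c * mu)) by rewrite expr2; ring.
by rewrite ler_wpM2r ?ler_pM// divr_ge0// ltW.
Qed.

End ResolventDecay.

(** * Square summable functions and local operators *)

Section SquareSums.
Variables (R : realType) (V : choiceType) (N : nat).
Implicit Types (f g x : V -> R) (c : R) (a : V -> 'I_N -> R) (p : V -> 'I_N -> V).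

(** Finite partial sums express summability and a bound on the squared norm at once, and they pass
    directly to pointwise limits. *)
Definition sqsum_le f c : Prop :=
  forall s : seq V, uniq s -> \sum_(v <- s) f v ^+ 2 <= c.

(** A matrix indexed by [V] with at most [N] entries per row: the entry number [i] of row [u] is
    [a u i], in column [p u i]. *)
Definition local_op a p f : V -> R := fun u => \sum_(i < N) a u i * f (p u i).

Lemma eq_sqsum_le f g c : f =1 g -> sqsum_le f c -> sqsum_le g c.
Proof.
move=> fg fc s us; apply: le_trans (fc s us).
by apply: ler_sum => v _; rewrite fg.
Qed.

Lemma sqsum_le_entry f c u : sqsum_le f c -> f u ^+ 2 <= c.
Proof. by move=> /(_ [:: u] isT); rewrite big_seq1. Qed.

Lemma sqsum_le_ge0 f c : sqsum_le f c -> 0 <= c.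
Proof. by move=> /(_ [::] isT); rewrite big_nil. Qed.

Lemma sqsum_leW f c c' : c <= c' -> sqsum_le f c -> sqsum_le f c'.
Proof. by move=> cc fc s us; apply: le_trans cc; exact: fc. Qed.

Lemma sqsum_leN f c : sqsum_le f c -> sqsum_le (fun u => - f u) c.
Proof.
move=> fc s us; apply: le_trans (fc s us).
by apply: ler_sum => v _; rewrite sqrrN.
Qed.

Lemma sqsum_leD f g c c' : sqsum_le f c -> sqsum_le g c' ->
  sqsum_le (fun u => f u + g u) (2 * c + 2 * c').
Proof.
move=> fc gc s us.
apply: (@le_trans _ _ (\sum_(v <- s) (2 * f v ^+ 2 + 2 * g v ^+ 2))).
  apply: ler_sum => v _; rewrite -subr_ge0.
  have -> : 2 * f v ^+ 2 + 2 * g v ^+ 2 - (f v + g v) ^+ 2 = (f v - g v) ^+ 2.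
    by ring.
  exact: sqr_ge0.
by rewrite big_split/= -!mulr_sumr lerD// ler_wpM2l// ?fc ?gc.
Qed.

Lemma sqsum_leM h f k c : (forall u, `|h u| <= k) -> sqsum_le f c ->
  sqsum_le (fun u => h u * f u) (k ^+ 2 * c).
Proof.
move=> hk fc s us.
apply: (@le_trans _ _ (\sum_(v <- s) (k ^+ 2 * f v ^+ 2))).
  apply: ler_sum => v _; rewrite exprMn ler_wpM2r ?sqr_ge0//.
  rewrite -[h v ^+ 2]real_normK ?num_real//.
  by rewrite lerXn2r ?nnegrE ?(le_trans _ (hk v)).
by rewrite -mulr_sumr ler_wpM2l ?sqr_ge0// fc.
Qed.

Lemma sqsum_leZ k f c : sqsum_le f c ->
  sqsum_le (fun u => k * f u) (k ^+ 2 * c).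
Proof.
move=> fc; rewrite -[k ^+ 2]real_normK ?num_real//.
exact: (sqsum_leM (h := fun=> k)).
Qed.

Lemma cvgr_sum (I : Type) (r : seq I) (y : nat -> I -> R) (l : I -> R) :
  (forall i, y n i @[n --> \oo] --> l i) ->
  (\sum_(i <- r) y n i) @[n --> \oo] --> \sum_(i <- r) l i.
Proof.
move=> yl; elim: r => [|i r IHr].
  rewrite big_nil (_ : (fun _ => _) = cst 0); first exact: cvg_cst.
  by apply/funext => n; rewrite big_nil.
rewrite big_cons (_ : (fun _ => _) = (fun n => y n i + \sum_(j <- r) y n j)).
  exact: cvgD.
by apply/funext => n; rewrite big_cons.
Qed.

Lemma sqsum_le_lim (y : nat -> V -> R) x c :
  (forall u, y n u @[n --> \oo] --> x u) -> (forall n, sqsum_le (y n) c) ->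
  sqsum_le x c.
Proof.
move=> yx yc s us.
have cv : (\sum_(v <- s) y n v ^+ 2) @[n --> \oo] --> \sum_(v <- s) x v ^+ 2.
  apply: cvgr_sum => v; rewrite expr2.
  rewrite (_ : (fun n => _) = (fun n => y n v * y n v)); last first.
    by apply/funext => n; rewrite expr2.
  exact: cvgM.
by apply: (cvgr_to_le cv); apply: nearW => n; exact: yc.
Qed.

Lemma sqr_sum_le (I : finType) (z : I -> R) :
  (\sum_i z i) ^+ 2 <= #|I|%:R * \sum_i z i ^+ 2.
Proof.
rewrite expr2 mulr_suml.
apply: (@le_trans _ _ (\sum_i \sum_j ((z i ^+ 2 + z j ^+ 2) / 2))).
  apply: ler_sum => i _; rewrite mulr_sumr; apply: ler_sum => j _.
  rewrite -subr_ge0 (_ : _ - _ = (z i - z j) ^+ 2 / 2); last by field.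
  by rewrite divr_ge0// sqr_ge0.
have -> : \sum_i \sum_j ((z i ^+ 2 + z j ^+ 2) / 2)
    = \sum_i (#|I|%:R * (z i ^+ 2 / 2) + (\sum_j z j ^+ 2) / 2).
  apply: eq_bigr => i _.
  under eq_bigr do rewrite mulrDl.
  by rewrite big_split/= sumr_const mulr_natl mulr_suml.
rewrite big_split/= sumr_const -mulr_sumr -mulr_suml -[X in _ + X]mulr_natl.
by rewrite -mulrDr -splitr.
Qed.

Lemma local_opD a p f g u :
  local_op a p (fun v => f v + g v) u = local_op a p f u + local_op a p g u.
Proof. by rewrite -big_split; apply: eq_bigr => i _; rewrite mulrDr. Qed.

Lemma local_opN a p f u : local_op a p (fun v => - f v) u = - local_op a p f u.
Proof. by rewrite -sumrN; apply: eq_bigr => i _; rewrite mulrN. Qed.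

Lemma eq_local_op a p f g : f =1 g -> local_op a p f =1 local_op a p g.
Proof. by move=> fg u; apply: eq_bigr => i _; rewrite fg. Qed.

Lemma local_op_cvg a p (y : nat -> V -> R) x u :
  (forall v, y n v @[n --> \oo] --> x v) ->
  local_op a p (y n) u @[n --> \oo] --> local_op a p x u.
Proof. by move=> yx; apply: cvgr_sum => i; apply: cvgM => //; exact: cvg_cst. Qed.

(* The injectivity hypothesis bounds the number of nonzero entries in each
   column of the matrix of the operator by N. *)
Lemma sqsum_le_local_op a p (cls : V -> 'I_N) k f c :
  (forall u i, `|a u i| <= k) ->
  (forall u v i, cls u = cls v -> a u i != 0 -> a v i != 0 ->
    p u i = p v i -> u = v) ->
  sqsum_le f c -> sqsum_le (local_op a p f) (N%:R ^+ 3 * k ^+ 2 * c).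
Proof.
move=> ak injp fc s us.
have c0 := sqsum_le_ge0 fc.
pose t u i := if a u i != 0 then f (p u i) ^+ 2 else 0.
(* One factor [N] comes from Cauchy-Schwarz in each row, one from the sum over [i], one from the
   number of classes. *)
apply: (@le_trans _ _ (\sum_(u <- s) (N%:R * \sum_i k ^+ 2 * t u i))).
  apply: ler_sum => u _; rewrite -{1}[N]card_ord.
  apply: le_trans (sqr_sum_le _) _.
  rewrite card_ord ler_wpM2l//; apply: ler_sum => i _; rewrite exprMn /t.
  have [->|_] := eqVneq (a u i) 0; first by rewrite expr0n mul0r mulr0.
  rewrite ler_wpM2r ?sqr_ge0// -[a u i ^+ 2]real_normK ?num_real//.
  by rewrite lerXn2r ?nnegrE ?(le_trans _ (ak u i)).
rewrite -mulr_sumr exchange_big/=.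
apply: (@le_trans _ _ (N%:R * \sum_(i < N) (k ^+ 2 * (N%:R * c)))); last first.
  rewrite sumr_const card_ord -[X in _ * X]mulr_natl.
  by rewrite [leLHS](_ : _ = N%:R ^+ 3 * k ^+ 2 * c)//; ring.
rewrite ler_wpM2l//; apply: ler_sum => i _.
rewrite -mulr_sumr ler_wpM2l ?sqr_ge0//.
(* Within one class the columns of the nonzero entries number [i] are distinct, so [fc] applies to
   their list. *)
rewrite (partition_big cls xpredT)//=.
have -> : N%:R * c = \sum_(j < N) c by rewrite sumr_const card_ord mulr_natl.
apply: ler_sum => j _; rewrite /t -big_mkcondr/= -big_filter.
rewrite -(big_map (p ^~ i) xpredT (fun v => f v ^+ 2)); apply: fc.
rewrite map_inj_in_uniq ?filter_uniq// => u v.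
rewrite !mem_filter => /andP[/andP[/eqP uj au] _] /andP[/andP[/eqP vj av] _].
by apply: injp => //; rewrite uj.
Qed.

End SquareSums.

(** * Neumann series for the equation x = A f - A P x *)

Section Parametrix.
Variables (R : realType) (V : choiceType) (N : nat).
Variables (a b : V -> 'I_N -> R) (p q : V -> 'I_N -> V).
Variables (w : V -> R) (alpha beta : R).
Hypothesis w_gt0 : forall u, 0 < w u.
Let A := local_op a p.
Let P := local_op b q.
Hypothesis A_bound : forall f c, sqsum_le (fun u => (w u)^-1 * f u) c ->
  sqsum_le (fun u => w u * A f u) (alpha * c).
Hypothesis P_bound : forall f c, sqsum_le (fun u => w u * f u) c ->
  sqsum_le (fun u => (w u)^-1 * P f u) (beta * c).
Hypothesis contraction : alpha * beta <= 4^-1.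

(** [alpha] and [beta] bound squared norms, so their product 1/4 means norm at most 1/2 for A P. *)
Lemma AP_contraction f c : sqsum_le (fun u => w u * f u) c ->
  sqsum_le (fun u => w u * A (P f) u) (c / 4).
Proof.
move=> fc; have c0 := sqsum_le_ge0 fc.
apply: sqsum_leW (A_bound (P_bound fc)).
by rewrite mulrA [leRHS]mulrC ler_wpM2r.
Qed.

Lemma geometric_sqsum_le_eq0 (y : V -> R) c :
  (forall k, sqsum_le (fun u => w u * y u) (c / 4 ^+ k)) -> forall u, y u = 0.
Proof.
move=> yc u; apply/eqP.
rewrite -[_ == 0](mulrI_eq0 _ (lregP (lt0r_neq0 (w_gt0 u)))).
rewrite -sqrf_eq0 eq_le sqr_ge0 andbT.
have cv : (geometric c 4^-1 k : R) @[k --> \oo] --> 0.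
  by apply: cvg_geometric; rewrite ger0_norm ?invr_ge0// invf_lt1// ltr1n.
apply: (cvgr_to_ge cv); apply: nearW => k /=.
by rewrite exprVn; exact: (sqsum_le_entry u (yc k)).
Qed.

Lemma parametrix_unique y c : sqsum_le (fun u => w u * y u) c ->
  (forall u, y u = - A (P y) u) -> forall u, y u = 0.
Proof.
move=> yc yE; apply: (@geometric_sqsum_le_eq0 _ c) => k.
elim: k => [|k IHk]; first by rewrite expr0 divr1.
have := sqsum_leN (AP_contraction IHk).
rewrite exprSr invfM mulrA; apply: eq_sqsum_le => u.
by rewrite [y u in RHS]yE mulrN.
Qed.

(** The solution is the pointwise sum of the terms [y k], which are the iterates of -A P on A f. *)
Lemma parametrix_solution f c : sqsum_le (fun u => (w u)^-1 * f u) c ->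
  exists x, sqsum_le (fun u => w u * x u) (4 * (alpha * c)) /\
    forall u, x u = A f u - A (P x) u.
Proof.
move=> fc; have Af := A_bound fc; have c0 := sqsum_le_ge0 Af.
pose y := fix y k := if k is k'.+1 then (fun u => - A (P (y k')) u) else A f.
have yb k : sqsum_le (fun u => w u * y k u) (alpha * c / 4 ^+ k).
  elim: k => [|k IHk]; first by rewrite expr0 divr1.
  have := sqsum_leN (AP_contraction IHk).
  by rewrite exprSr invfM mulrA; apply: eq_sqsum_le => u /=; rewrite mulrN.
pose X n u := \sum_(0 <= k < n) y k u.
have XS n u : X n.+1 u = A f u - A (P (X n)) u.
  elim: n u => [|n IHn] u.
    rewrite /X big_nat1/= (_ : A (P _) u = 0) ?subr0//.
    rewrite /A /P /local_op big1// => i _; rewrite big1 ?mulr0// => j _.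
    by rewrite big_nil mulr0.
  rewrite {1}/X big_nat_recr//= -/(X n.+1 u) IHn -addrA -opprD; congr (_ - _).
  rewrite /A -local_opD; apply: eq_local_op => v; rewrite /P -local_opD.
  by apply: eq_local_op => v'; rewrite /X big_nat_recr.
have Xb n : sqsum_le (fun u => w u * X n u) (4 * (alpha * c)).
  elim: n => [|n IHn].
    move=> s _; rewrite big1 ?(mulr_ge0 _ c0)// => u _.
    by rewrite /X big_nil mulr0 expr0n.
  (* The constant 4 reproduces itself: [2 * t + 2 * (4 * t / 4) = 4 * t] for [t = alpha * c]. *)
  have := sqsum_leD Af (sqsum_leN (AP_contraction IHn)).
  rewrite (_ : _ + _ = 4 * (alpha * c)); last by field.
  by apply: eq_sqsum_le => u /=; rewrite XS mulrBr.
(* At a fixed vertex the terms are dominated by a geometric series of ratio 1/2. *)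
have Xcvg u : cvgn (fun n => X n u).
  apply: (@normed_cvg _ (R : completeNormedModType R) (y ^~ u)).
  pose g : R^nat := geometric (Num.sqrt (alpha * c) / w u) 2^-1.
  apply: (@series_le_cvg _ _ g) => [k|k|k|]; rewrite /g.
  - exact: normr_ge0.
  - rewrite /geometric/= mulr_ge0 ?divr_ge0 ?sqrtr_ge0 ?exprn_ge0 ?invr_ge0//.
    exact: ltW.
  - rewrite /geometric/= exprVn mulrAC ler_pdivlMr// mulrC -[w u]gtr0_norm//.
    rewrite -normrM -sqrtr_sqr.
    have -> : Num.sqrt (alpha * c) / 2 ^+ k = Num.sqrt (alpha * c / 4 ^+ k).
      have -> : (4 ^+ k : R)^-1 = (2 ^+ k)^-1 ^+ 2.
        by rewrite exprVn -exprM mulnC exprM -(natrX _ 2 2).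
      by rewrite (sqrtrM _ c0) sqrtr_sqr ger0_norm// invr_ge0 exprn_ge0.
    by rewrite ler_wsqrtr// (sqsum_le_entry u (yb k)).
  - apply: is_cvg_geometric_series.
    by rewrite ger0_norm ?invr_ge0// invf_lt1// ltr1n.
pose x u := limn (fun n => X n u).
have Xx u : X n u @[n --> \oo] --> x u by exact: Xcvg.
exists x; split.
  apply: (@sqsum_le_lim R V (fun n u => w u * X n u)) => // u.
  by apply: cvgM; [exact: cvg_cst|exact: Xx].
(* The recursion [XS] passes to the pointwise limit because every row has finitely many entries. *)
move=> u; have /cvg_unique : X n.+1 u @[n --> \oo] --> x u.
  by have := Xx u; rewrite -(cvg_shiftS (fun n => X n u)).
apply => //; rewrite (_ : (fun n => _) = (fun n => A f u - A (P (X n)) u)).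
  apply: cvgB; first exact: cvg_cst.
  by apply: local_op_cvg => v; apply: local_op_cvg.
by apply/funext => n; rewrite XS.
Qed.

End Parametrix.

(** * A criterion for the resolvent set *)

Section ResolventCriterion.
Variables (R : realType) (V : choiceType).
Implicit Types (f : V -> R[i]).

Lemma normc_sqr (z : R[i]) :
  Normc.normc z ^+ 2 = complex.Re z ^+ 2 + complex.Im z ^+ 2.
Proof. by case: z => x y /=; rewrite sqr_sqrtr// addr_ge0// sqr_ge0. Qed.

Lemma l2_sum_ge0 f : (0 <= l2_sum f)%E.
Proof. by apply: esum_ge0 => v _; rewrite lee_fin sqr_ge0. Qed.

Lemma l2_sumK f : l2 f -> ((fine (l2_sum f))%:E = l2_sum f)%E.
Proof. by move=> lf; rewrite fineK// ge0_fin_numE// l2_sum_ge0. Qed.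

Lemma l2_normc_sum_le f (s : seq V) : l2 f -> uniq s ->
  \sum_(v <- s) Normc.normc (f v) ^+ 2 <= fine (l2_sum f).
Proof.
move=> lf us; rewrite -lee_fin l2_sumK// -sumEFin fsbig_seq//.
by apply: ereal_sup_ubound; exists [set` s].
Qed.

Lemma l2_sqsum_le f : l2 f ->
  sqsum_le (@complex.Re R \o f) (fine (l2_sum f)) /\
  sqsum_le (@complex.Im R \o f) (fine (l2_sum f)).
Proof.
move=> lf; split=> s us; apply: le_trans (l2_normc_sum_le lf us);
  apply: ler_sum => v _; rewrite normc_sqr/=.
  by rewrite lerDl sqr_ge0.
by rewrite lerDr sqr_ge0.
Qed.

Lemma sqsum_le_l2 f c c' :
  sqsum_le (@complex.Re R \o f) c -> sqsum_le (@complex.Im R \o f) c' ->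
  l2 f /\ fine (l2_sum f) <= c + c'.
Proof.
move=> rec imc.
have H : (l2_sum f <= (c + c')%:E)%E.
  apply: ge_ereal_sup => _ [X [finX _] <-].
  rewrite fsbig_finite//= sumEFin lee_fin.
  under eq_bigr do rewrite normc_sqr.
  by rewrite big_split/= lerD// (rec, imc).
have lf : l2 f by exact: le_lt_trans H (ltry _).
by split=> //; rewrite -lee_fin l2_sumK.
Qed.

Variables (T : (V -> R[i]) -> V -> R[i]) (H : (V -> R) -> V -> R).
Variables (lam M : R).
Hypothesis TE : forall f v,
  T f v = (H (@complex.Re R \o f) v +i* H (@complex.Im R \o f) v).
Hypothesis HD : forall x y u, H (fun v => x v + y v) u = H x u + H y u.
Hypothesis HZ : forall k x u, H (fun v => k * x v) u = k * H x u.
Hypothesis H_solve : forall x c, sqsum_le x c ->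
  exists y, sqsum_le y (M * c) /\ forall u, H y u - lam * y u = x u.
Hypothesis H_inj : forall x c, sqsum_le x c ->
  (forall u, H x u = lam * x u) -> forall u, x u = 0.
Hypothesis M_ge0 : 0 <= M.

(** For square summable [x], [H_solve] and [H_inj] give exactly one square summable solution, so the
    default 0 is not taken there. *)
Let solver (x : V -> R) : V -> R :=
  xget (fun=> 0) [set y | (exists c, sqsum_le y c) /\
                          forall u, H y u - lam * y u = x u].

Let solver_unique x y c : sqsum_le y c ->
  (forall u, H y u - lam * y u = x u) -> solver x = y.
Proof.
move=> yc yx.
have [[c' zc'] zx] : (exists c, sqsum_le (solver x) c) /\
    forall u, H (solver x) u - lam * solver x u = x u.
  rewrite /solver; case: xgetP => [z _ //|/(_ y)[]].
  by split=> //; exists c.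
have zy u : solver x u + -1 * y u = 0.
  apply: (H_inj (sqsum_leD zc' (sqsum_leZ (-1) yc))) => v.
  by rewrite HD HZ; have := zx v; rewrite -(yx v); lra.
by apply/funext => u; have := zy u; lra.
Qed.

Let solverP x c : sqsum_le x c ->
  sqsum_le (solver x) (M * c) /\
  forall u, H (solver x) u - lam * solver x u = x u.
Proof.
by move=> /H_solve [y [yc yx]]; rewrite (solver_unique yc yx).
Qed.

(** The resolvent solves for the real and imaginary parts separately, as [T] acts on them
    separately. Uniqueness of solutions makes it complex linear and a left inverse. *)
Lemma not_in_real_spectrum : ~ real_spectrum T lam.
Proof.
apply; pose S f v :=
  (solver (@complex.Re R \o f) v +i* solver (@complex.Im R \o f) v).
have ReS f : @complex.Re R \o S f = solver (@complex.Re R \o f) by apply/funext.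
have ImS f : @complex.Im R \o S f = solver (@complex.Im R \o f) by apply/funext.
exists S; split; first split.
- move=> f /l2_sqsum_le[/solverP[rec _] /solverP[imc _]].
  by have [] // := @sqsum_le_l2 (S f) (M * fine (l2_sum f)) (M * fine (l2_sum f)).
- move=> [z1 z2] f g /l2_sqsum_le[ref imf] /l2_sqsum_le[reg img].
  have [refb refE] := solverP ref; have [imfb imfE] := solverP imf.
  have [regb regE] := solverP reg; have [imgb imgE] := solverP img.
  apply/funext => v; rewrite /S.
  rewrite (@solver_unique (@complex.Re R \o fun v => (z1 +i* z2) * f v + g v)
    (fun v => z1 * solver (@complex.Re R \o f) v
    + - z2 * solver (@complex.Im R \o f) v + solver (@complex.Re R \o g) v)
    _ (sqsum_leD (sqsum_leD (sqsum_leZ z1 refb) (sqsum_leZ (- z2) imfb)) regb));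
    last first.
    move=> u; rewrite !HD !HZ /=.
    have := refE u; have := imfE u; have := regE u => /=.
    by case: (f u) (g u) => [x1 x2] [y1 y2] /= <- <- <-; ring.
  rewrite (@solver_unique (@complex.Im R \o fun v => (z1 +i* z2) * f v + g v)
    (fun v => z1 * solver (@complex.Im R \o f) v
    + z2 * solver (@complex.Re R \o f) v + solver (@complex.Im R \o g) v)
    _ (sqsum_leD (sqsum_leD (sqsum_leZ z1 imfb) (sqsum_leZ z2 refb)) imgb));
    last first.
    move=> u; rewrite !HD !HZ /=.
    have := refE u; have := imfE u; have := imgE u => /=.
    by case: (f u) (g u) => [x1 x2] [y1 y2] /= <- <- <-; ring.
  by rewrite mulNr.
- exists (Num.sqrt (M + M)) => f /l2_sqsum_le[/solverP[rec _] /solverP[imc _]].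
  have [] := @sqsum_le_l2 (S f) (M * fine (l2_sum f)) (M * fine (l2_sum f)).
  + by rewrite ReS.
  + by rewrite ImS.
  + by move=> _ le; rewrite /l2_norm -sqrtrM ?addr_ge0// ler_wsqrtr// mulrDl.
move=> f lf; have [ref imf] := l2_sqsum_le lf; split.
  apply/funext => v; rewrite /S.
  rewrite (@solver_unique (@complex.Re R \o fun v => T f v - lam%:C * f v)
    (@complex.Re R \o f) _ ref); last first.
    move=> u; rewrite /= TE; case E: (f u) => [x1 x2] /=.
    by rewrite mul0r subr0.
  rewrite (@solver_unique (@complex.Im R \o fun v => T f v - lam%:C * f v)
    (@complex.Im R \o f) _ imf); last first.
    move=> u; rewrite /= TE; case E: (f u) => [x1 x2] /=.
    by rewrite mul0r addr0.
  by rewrite /=; case: (f v).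
apply/funext => v; rewrite TE ReS ImS.
have [_ /(_ v)/= reE] := solverP ref; have [_ /(_ v)/= imE] := solverP imf.
rewrite /S; apply/eqP; rewrite eq_complex /= mul0r subr0 mul0r addr0.
by rewrite reE imE !eqxx.
Qed.

End ResolventCriterion.

(** * Operators fibered over a finite set *)

Section FiberedOperator.
Variables (R : realType) (V : choiceType) (N : nat).
Variables (cls : V -> 'I_N) (edge kept : rel 'I_N).
Variables (nb pt : V -> 'I_N -> V).
Hypothesis pt_cls : forall u j, cls (pt u j) = j.
Hypothesis pt_pt : forall u i j, pt (pt u i) j = pt u j.
Hypothesis pt_id : forall u, pt u (cls u) = u.
Hypothesis kept_nb : forall u j,
  edge (cls u) j -> kept (cls u) j -> nb u j = pt u j.
Hypothesis nb_cls : forall u j, edge (cls u) j -> cls (nb u j) = j.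
Hypothesis nb_inj : forall u v j, cls u = cls v -> edge (cls u) j ->
  nb u j = nb v j -> u = v.
Variables (q : 'I_N -> R) (lam : R).

(** [V] splits into fibers with one point in each class, [pt u j] being the point of class [j] in
    the fiber of [u]. Kept edges stay inside a fiber, and this is the matrix they induce, with the
    potential, on every fiber. *)
Definition fiber_mx : 'M[R]_N :=
  \matrix_(i, j) ((edge i j && kept i j)%:R + (q i) *+ (i == j)).

Let S := fiber_mx - lam%:M.
Let r := invmx S.
Let A := local_op (fun u j => r (cls u) j) pt.
Let removed u j : R := (edge (cls u) j && ~~ kept (cls u) j)%:R.
Let P := local_op removed nb.
Let H (f : V -> R) u :=
  \sum_(j < N) (if edge (cls u) j then f (nb u j) else 0) + q (cls u) * f u.

Lemma fiber_op_mul (X Y : 'M[R]_N) f u :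
  local_op (fun u j => X (cls u) j) pt (local_op (fun u j => Y (cls u) j) pt f) u
  = local_op (fun u j => (X *m Y) (cls u) j) pt f u.
Proof.
rewrite /local_op.
under eq_bigr do rewrite mulr_sumr.
rewrite exchange_big/=; apply: eq_bigr => k _; rewrite mxE mulr_suml.
by apply: eq_bigr => j _; rewrite pt_cls pt_pt mulrA.
Qed.

Lemma fiber_op1 f u :
  local_op (fun u j => (1%:M : 'M[R]_N) (cls u) j) pt f u = f u.
Proof.
rewrite /local_op (bigD1 (cls u))//= big1 ?addr0 => [|j jn].
  by rewrite mxE eqxx mul1r pt_id.
by rewrite mxE eq_sym (negbTE jn) mul0r.
Qed.

Lemma fiber_op_split f u :
  H f u - lam * f u = local_op (fun u j => S (cls u) j) pt f u + P f u.
Proof.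
have -> : lam * f u = \sum_j (lam *+ (cls u == j)) * f (pt u j).
  rewrite (bigD1 (cls u))//= big1 ?addr0 => [|j jn]; first by rewrite eqxx pt_id.
  by rewrite eq_sym (negbTE jn) mul0r.
have -> : H f u = \sum_(j < N) (if edge (cls u) j then f (nb u j) else 0)
    + \sum_j (q (cls u) *+ (cls u == j)) * f (pt u j).
  congr (_ + _).
  rewrite (bigD1 (cls u))//= big1 ?addr0 => [|j jn]; first by rewrite eqxx pt_id.
  by rewrite eq_sym (negbTE jn) mul0r.
rewrite /P /local_op -sumrN -!big_split/=; apply: eq_bigr => j _.
rewrite /S /removed !mxE.
case: (boolP (edge _ _)) => e; case: (boolP (kept _ _)) => k /=;
  rewrite ?(kept_nb e k); ring.
Qed.

Variables (w : 'I_N -> R) (rho eps : R).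
Hypothesis S_unit : S \in unitmx.
Hypothesis w_gt0 : forall i, 0 < w i.
Hypothesis r_bound : forall i j, w i * `|r i j| * w j <= rho.
Hypothesis removed_weight : forall i j, edge i j -> ~~ kept i j ->
  1 <= eps * (w i * w j).
Hypothesis eps_ge0 : 0 <= eps.
Hypothesis small : (N%:R ^+ 3 * rho ^+ 2) * (N%:R ^+ 3 * eps ^+ 2) <= 4^-1.

Let W u := w (cls u).

Let W_gt0 u : 0 < W u. Proof. exact: w_gt0. Qed.

(** Conjugation by the weights turns [A] into an operator with coefficients [w i * r i j * w j], of
    absolute value at most [rho]. *)
Let A_bound f c : sqsum_le (fun u => (W u)^-1 * f u) c ->
  sqsum_le (fun u => W u * A f u) ((N%:R ^+ 3 * rho ^+ 2) * c).
Proof.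
move=> fc.
apply: (@eq_sqsum_le _ _ (local_op (fun u j => w (cls u) * r (cls u) j * w j) pt
          (fun u => (W u)^-1 * f u))).
  move=> u; rewrite /A /local_op mulr_sumr; apply: eq_bigr => j _.
  by rewrite /W pt_cls; field; rewrite gt_eqF.
apply: (sqsum_le_local_op (cls := cls)) fc => [u i|u v i uv _ _ e].
  by rewrite !normrM !(gtr0_norm (w_gt0 _)).
have : pt (pt u i) (cls u) = pt (pt v i) (cls v) by rewrite -uv e.
by rewrite !pt_pt !pt_id.
Qed.

(** On removed edges the conjugated coefficients are [(w i * w j)^-1], hence at most [eps]. *)
Let P_bound f c : sqsum_le (fun u => W u * f u) c ->
  sqsum_le (fun u => (W u)^-1 * P f u) ((N%:R ^+ 3 * eps ^+ 2) * c).
Proof.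
move=> fc.
apply: (@eq_sqsum_le _ _
  (local_op (fun u j => (W u)^-1 * removed u j * (W (nb u j))^-1) nb
     (fun u => W u * f u))).
  move=> u; rewrite /P /local_op mulr_sumr; apply: eq_bigr => j _.
  by field; rewrite !gt_eqF.
apply: (sqsum_le_local_op (cls := cls)) fc => [u i|u v i uv]; last first.
  rewrite /removed; case: (boolP (edge _ _)) => [e _ _|_]; last first.
    by rewrite mulr0 mul0r eqxx.
  exact: nb_inj.
rewrite /removed; case: (boolP (edge _ _)) => e; last first.
  by rewrite mulr0 mul0r normr0.
case: (boolP (kept _ _)) => k; first by rewrite mulr0 mul0r normr0.
rewrite mulr1 -invfM ger0_norm ?invr_ge0 ?mulr_ge0 ?(ltW (W_gt0 _))//.
rewrite -[leLHS]mul1r ler_pdivrMr ?mulr_gt0// /W nb_cls//.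
exact: removed_weight.
Qed.

Let SA f u :
  local_op (fun u j => S (cls u) j) pt (A f) u = f u.
Proof. by rewrite /A fiber_op_mul /r mulmxV// fiber_op1. Qed.

Let AS f u :
  A (local_op (fun u j => S (cls u) j) pt f) u = f u.
Proof. by rewrite /A fiber_op_mul /r mulVmx// fiber_op1. Qed.

(** As [A] inverts the kept part fiber by fiber, [H y - lam * y = x] amounts to [y = A x - A (P y)],
    the equation solved by the Neumann series. *)
Lemma fibered_not_in_spectrum (T : (V -> R[i]) -> V -> R[i]) :
  (forall f v, T f v = (H (@complex.Re R \o f) v +i* H (@complex.Im R \o f) v)) ->
  ~ real_spectrum T lam.
Proof.
move=> TE.
(* [wm] dominates every weight and its inverse, so weighted and unweighted norms are equivalent. *)
pose wm := \sum_i (w i + (w i)^-1).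
have wt0 i : 0 <= w i + (w i)^-1 by rewrite addr_ge0 ?invr_ge0 ?ltW.
have wm0 : 0 <= wm by apply: sumr_ge0.
have wle i : w i + (w i)^-1 <= wm.
  by rewrite /wm (bigD1 i)//= lerDl sumr_ge0.
have Wle u : `|W u| <= wm.
  rewrite gtr0_norm//; apply: le_trans (wle (cls u)).
  by rewrite lerDl invr_ge0 ltW.
have Wile u : `|(W u)^-1| <= wm.
  rewrite gtr0_norm ?invr_gt0//; apply: le_trans (wle (cls u)).
  by rewrite lerDr ltW.
pose al := N%:R ^+ 3 * rho ^+ 2.
have al0 : 0 <= al by rewrite mulr_ge0 ?sqr_ge0// exprn_ge0.
apply: (@not_in_real_spectrum _ _ T H lam (wm ^+ 2 * (4 * (al * wm ^+ 2)))) => //.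
move=> x y u; rewrite /H mulrDr addrACA; congr (_ + _).
  rewrite -big_split/=; apply: eq_bigr => j _; by case: ifP; rewrite ?addr0.
move=> k x u; rewrite /H mulrDr mulrCA; congr (_ + _).
  rewrite mulr_sumr; apply: eq_bigr => j _; by case: ifP; rewrite ?mulr0.
move=> x c xc.
  have [y [yc yE]] :=
    parametrix_solution W_gt0 A_bound P_bound small (sqsum_leM Wile xc).
  exists y; split.
    have := sqsum_leM Wile yc; rewrite -/al -!mulrA.
    by apply: eq_sqsum_le => u; rewrite mulKf// gt_eqF.
  move=> u; rewrite fiber_op_split.
  have /eq_local_op -> : y =1 A (fun v => x v + - P y v).
    by move=> v; rewrite yE /A local_opD local_opN.
  by rewrite SA subrK.
move=> x c xc Hx.
  apply: (parametrix_unique W_gt0 A_bound P_bound small (sqsum_leM Wle xc)) => u.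
  rewrite -[LHS]AS /A -local_opN; apply: eq_local_op => v.
  have := fiber_op_split x v; rewrite Hx subrr => /eqP.
  by rewrite eq_sym addr_eq0 => /eqP.
exact: mulr_ge0 (sqr_ge0 _) (mulr_ge0 (ler0n R 4) (mulr_ge0 al0 (sqr_ge0 _))).
Qed.

End FiberedOperator.

(** * Walks and distances in the quotient graph *)

Section QuotientPaths.
Context (R : realType) (d : nat) (G : zd_graph R d).
Hypothesis hG : periodic_graph G.
Implicit Types (e f : qarc G) (x y z : qvertex G) (p c : seq (qarc G)).

Definition qpi (u : G) : qvertex G := \pi_(qvertex G) u.

Lemma qpi_eqP (u v : G) : reflect (exists n, shift n u = v) (qpi u == qpi v).
Proof. by rewrite eqmodE; exact: asboolP. Qed.

Definition adj_arc (u v : G) (uv : adj u v) : arc G := exist _ (u, v) uv.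
Definition adj_qarc (u v : G) (uv : adj u v) : qarc G :=
  \pi_(qarc G) (adj_arc uv).

Lemma adj_qarc_src u v (uv : adj u v) : qsrc (adj_qarc uv) = qpi u.
Proof. by rewrite /adj_qarc qsrc_pi. Qed.

Lemma adj_qarc_tgt u v (uv : adj u v) : qtgt (adj_qarc uv) = qpi v.
Proof. by rewrite /adj_qarc qtgt_pi. Qed.

Lemma adj_qarc_index u v (uv : adj u v) :
  qarc_index (adj_qarc uv) = cell v - cell u.
Proof. by rewrite /adj_qarc qarc_index_pi. Qed.

Lemma adjC (u v : G) : adj u v -> adj v u.
Proof. by rewrite adj_sym. Qed.

Lemma qarc_adj e : adj (arc_src (repr e)) (arc_tgt (repr e)).
Proof. exact: (valP (repr e)). Qed.

Definition qrev e : qarc G := adj_qarc (adjC (qarc_adj e)).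

Lemma qrev_src e : qsrc (qrev e) = qtgt e.
Proof. by rewrite /qrev adj_qarc_src. Qed.

Lemma qrev_tgt e : qtgt (qrev e) = qsrc e.
Proof. by rewrite /qrev adj_qarc_tgt. Qed.

Lemma qrev_index e : qarc_index (qrev e) = - qarc_index e.
Proof. by rewrite /qrev adj_qarc_index opprB. Qed.

Lemma qpath_cat x y z p c : qpath x p y -> qpath y c z -> qpath x (p ++ c) z.
Proof.
elim: p x => [|e p IHp] x /=; first by move=> /eqP ->.
by move=> /andP[-> /IHp].
Qed.

Lemma qpath_catP x z p c : qpath x (p ++ c) z ->
  exists2 y, qpath x p y & qpath y c z.
Proof.
elim: p x => [|e p IHp] x /=; first by exists x.
by move=> /andP[-> /IHp].
Qed.

Lemma qpath_rev x y p : qpath x p y -> qpath y (map qrev (rev p)) x.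
Proof.
elim: p x => [|e p IHp] x /=; first by move=> /eqP ->.
move=> /andP[/eqP <- /IHp]; rewrite rev_cons map_rcons -cats1.
move=> /qpath_cat; apply.
by rewrite /= qrev_src qrev_tgt !eqxx.
Qed.

Lemma qpath_index_cat p c : qpath_index (p ++ c) = qpath_index p + qpath_index c.
Proof. exact: big_cat. Qed.

Lemma qpath_index_cons e p : qpath_index (e :: p) = qarc_index e + qpath_index p.
Proof. exact: big_cons. Qed.

Lemma qpath_index_rev p : qpath_index (map qrev (rev p)) = - qpath_index p.
Proof.
rewrite /qpath_index big_map big_rev -sumrN.
by apply: eq_bigr => e _; rewrite qrev_index.
Qed.

Lemma qpath_exists x y : exists p, qpath x p y.
Proof.
suff H (s : seq G) u : path adj u s -> exists p, qpath (qpi u) p (qpi (last u s)).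
  have [s us vs] := graph_connected hG (repr x) (repr y).
  by have := H s _ us; rewrite vs /qpi !reprK.
elim: s u => [|v s IHs] u /=; first by exists [::] => /=.
move=> /andP[uv /IHs[p vp]]; exists (adj_qarc uv :: p) => /=.
by rewrite adj_qarc_src adj_qarc_tgt eqxx.
Qed.

Lemma nonuniq_map_split (T U : eqType) (h : T -> U) (s : seq T) :
  ~~ uniq (map h s) ->
  exists s1 s2 s3 a b, s = s1 ++ (a :: s2) ++ (b :: s3) /\ h a = h b.
Proof.
elim: s => //= a s IHs; rewrite negb_and negbK => /orP[/mapP[b]|/IHs].
  by move=> /splitPr[s2 s3] hab; exists [::], s2, s3, a, b.
by move=> [s1 [s2 [s3 [b [c [-> bc]]]]]]; exists (a :: s1), s2, s3, b, c.
Qed.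

(* Cutting at a repeated vertex splits a closed walk into two shorter ones; a
   walk that cannot be cut is a cycle, or an edge followed by its reversal. *)
Lemma closed_walk_index0 (K : pred (qarc G)) :
  (forall c, qcycle c -> all K c -> qpath_index c = 0) ->
  forall x p, qpath x p x -> all K p -> qpath_index p = 0.
Proof.
move=> cyc x p; have [n] := ubnP (size p).
elim: n x p => // n IHn x p; rewrite ltnS => pn px Kp.
have [up|] := boolP (uniq (map (@qsrc _ _ _) p)); last first.
  move=> /nonuniq_map_split[s1 [s2 [s3 [a [b [pE ab]]]]]]; subst p.
  have [y x1 y2] := qpath_catP px; have [z y3 z4] := qpath_catP y2.
  have ya : qsrc a = y by case/andP: y3 => /eqP.
  have zb : qsrc b = z by case/andP: z4 => /eqP.
  have yz : y = z by rewrite -ya -zb.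
  rewrite -yz in y3 z4.
  move: Kp pn; rewrite !all_cat => /and3P[K1 K2 K3]; rewrite !size_cat => pn.
  rewrite !qpath_index_cat (IHn y _ _ y3 K2) ?add0r; last first.
    apply: leq_trans pn; apply: leq_trans (leq_addl (size s1) _).
    by rewrite /= addnS ltnS leq_addr.
  rewrite -qpath_index_cat (IHn x _ _ (qpath_cat x1 z4)) ?all_cat ?K1//.
  apply: leq_trans pn; rewrite size_cat ltn_add2l.
  by rewrite /= ltnS leq_addl.
case: p => [|e [|f [|g p]]] in pn px Kp up *.
- by rewrite /qpath_index big_nil.
- move: px => /= /andP[/eqP ex /eqP xe].
  by case: (quotient_no_loop hG (e := e)); rewrite ex xe.
- move: px => /= /and3P[/eqP ex /eqP fe /eqP fx].
  have -> : f = qrev e.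
    by apply: (quotient_no_multiple hG); rewrite ?qrev_src ?qrev_tgt ?fe ?fx ?ex.
  by rewrite /qpath_index big_cons big_seq1 qrev_index subrr.
- by apply: cyc => //; split=> //; exists x.
Qed.

(** A discrete potential: [phi x] is minus the index of a chosen K-walk from [x] to the root of its
    K-component. Closed K-walks having index 0, the index of an arc is the difference of [phi] at
    its ends. *)
Lemma kept_gauge (K : pred (qarc G)) :
  (forall e, K e -> K (qrev e)) ->
  (forall c, qcycle c -> all K c -> qpath_index c = 0) ->
  exists phi : qvertex G -> 'rV[int]_d,
    forall e, K e -> qarc_index e = phi (qtgt e) - phi (qsrc e).
Proof.
move=> Krev cyc.
pose conn x : pred (qvertex G) :=
  fun y => `[< exists p, all K p /\ qpath x p y >].
have connP x y : reflect (exists p, all K p /\ qpath x p y) (conn x y).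
  exact: asboolP.
have conn_refl x : conn x x by apply/connP; exists [::]; split=> //=.
have Kmaprev p : all K p -> all K (map qrev (rev p)).
  rewrite all_map all_rev => /allP Kp; apply/allP => e /Kp /=; exact: Krev.
(* [choose] returns the same element for extensionally equal predicates, so both ends of a K-arc get
   the same root. *)
pose root x := choose (conn x) x.
have conn_root x : conn x (root x) by exact: chooseP.
pose pth x := xget [::] [set p | all K p /\ qpath x p (root x)].
have pthP x : all K (pth x) /\ qpath x (pth x) (root x).
  rewrite /pth; case: xgetP => [p _ //|]; have /connP[p pP] := conn_root x.
  by move=> /(_ p) [].
exists (fun x => - qpath_index (pth x)) => e Ke.
have rE : root (qsrc e) = root (qtgt e).
  have H : conn (qsrc e) =1 conn (qtgt e).
    move=> z; apply/connP/connP => -[p [Kp pz]].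
      exists (qrev e :: p); split=> /=; first by rewrite Krev.
      by rewrite qrev_src qrev_tgt eqxx.
    by exists (e :: p); split=> /=; rewrite ?Ke ?eqxx.
  rewrite /root -(eq_choose H); apply: choose_id => //.
  by rewrite H conn_refl.
have [Ks ps] := pthP (qsrc e); have [Kt pt] := pthP (qtgt e).
set s := pth (qsrc e) in Ks ps *; set t := pth (qtgt e) in Kt pt *.
(* Closed walk: along [e], on to the common root, and back along the reversed walk of the source. *)
have cl : qpath (qsrc e) ((e :: t) ++ map qrev (rev s)) (qsrc e).
  apply: (@qpath_cat _ (root (qtgt e))); first by rewrite /= eqxx pt.
  by rewrite -rE; exact: qpath_rev.
have /(closed_walk_index0 cyc cl) : all K ((e :: t) ++ map qrev (rev s)).
  by rewrite all_cat /= Ke Kt Kmaprev.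
rewrite qpath_index_cat qpath_index_cons qpath_index_rev => /eqP.
rewrite opprK -addrA addr_eq0 => /eqP ->; by rewrite opprD opprK.
Qed.

Lemma qdist_le x y p : qpath x p y -> (qdist x y <= size p)%N.
Proof.
move=> xy; have [] := @nat_minP [set size p | p in [set p | qpath x p y]].
  by exists (size p); exists p.
by move=> _; apply; exists p.
Qed.

Lemma qdist_path x y : exists2 p, qpath x p y & size p = qdist x y.
Proof.
have [p xy] := qpath_exists x y.
have [] := @nat_minP [set size p | p in [set p | qpath x p y]].
  by exists (size p); exists p.
by move=> [c xc cE] _; exists c.
Qed.

Variable Q : G -> R.

Lemma dist_level_self x : dist_level Q (qpotential Q x) x = 0%N.
Proof.
have [] := @nat_minP [set qdist x y | y in qlevel Q (qpotential Q x)].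
  by exists (qdist x x); exists x.
move=> _ /(_ (qdist x x)) H; apply/eqP; rewrite -leqn0.
apply: leq_trans (H _) (@qdist_le x x [::] _) => //=; by exists x.
Qed.

Lemma dist_level_lip a e : qlevel Q a !=set0 ->
  (dist_level Q a (qsrc e) <= (dist_level Q a (qtgt e)).+1)%N.
Proof.
move=> [z az].
have [] := @nat_minP [set qdist (qtgt e) y | y in qlevel Q a].
  by exists (qdist (qtgt e) z); exists z.
move=> [y ay yE] _; rewrite {2}/dist_level -yE.
have [p py <-] := qdist_path (qtgt e) y.
have [] := @nat_minP [set qdist (qsrc e) y | y in qlevel Q a].
  by exists (qdist (qsrc e) z); exists z.
move=> _ H; apply: leq_trans (H (qdist (qsrc e) y) _) _; first by exists y.
by apply: (@qdist_le _ _ (e :: p)); rewrite /= eqxx.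
Qed.

Lemma light_cycle_index0 a c : qcycle c ->
  all (fun e => edge_weight Q a e < omega_level Q a)%N c -> qpath_index c = 0.
Proof.
move=> cyc lc; apply: contrapT => ic.
have [] := @nat_minP
  [set (\max_(e <- c) edge_weight Q a e)%N | c in @nontrivial_cycles _ _ G].
  by exists (\max_(e <- c) edge_weight Q a e)%N; exists c.
move=> _ /(_ (\max_(e <- c) edge_weight Q a e)%N) H.
have : (omega_level Q a <= \max_(e <- c) edge_weight Q a e)%N.
  by apply: H; exists c.
apply/negP; rewrite -ltnNge.
case: cyc => + _ _; case: c lc {ic H} => // e c lc _.
have : all (fun e => edge_weight Q a e < omega_level Q a)%N (e :: c) by [].
move: (e :: c) => s.
(* A light arc forces [omega_level] to be positive; the strict bound for the empty maximum, which is
   0, rests on this. *)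
have /andP[/(leq_ltn_trans (leq0n _)) om _] := lc.
elim: s => [|f s IHs]; first by rewrite big_nil.
by move=> /= /andP[fo /IHs so]; rewrite big_cons gtn_max fo.
Qed.

End QuotientPaths.

(** * Coordinates adapted to the kept arcs *)

Section Coordinates.
Context (R : realType) (d : nat) (G : zd_graph R d).
Hypothesis hG : periodic_graph G.

Lemma qvertex_enum : exists N (qv : 'I_N -> qvertex G) (ci : qvertex G -> 'I_N),
  cancel ci qv /\ cancel qv ci.
Proof.
have [s0 s0E] := (finite_seqP _).1 (quotient_vertices_finite hG).
pose s := undup s0.
have us : uniq s by exact: undup_uniq.
have ms x : x \in s.
  by rewrite mem_undup; have : [set: qvertex G] x by []; rewrite s0E.
have lts x : (index x s < size s)%N by rewrite index_mem.
exists (size s), (tnth (in_tuple s)), (fun x => Ordinal (lts x)); split.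
  by move=> x; rewrite (tnth_nth x)/= nth_index.
move=> i; apply/val_inj => /=.
by rewrite (tnth_nth (tnth (in_tuple s) i)) index_uniq.
Qed.

Variables (N : nat) (qv : 'I_N -> qvertex G) (ci : qvertex G -> 'I_N).
Hypotheses (ciK : cancel ci qv) (qvK : cancel qv ci).

Definition class_of (u : G) : 'I_N := ci (qpi u).

Definition qedge : rel 'I_N :=
  fun i j => `[< exists e : qarc G, qsrc e = qv i /\ qtgt e = qv j >].

(* Meaningful only when [qedge (class_of u) j]; otherwise u itself. *)
Definition nbr (u : G) (j : 'I_N) : G :=
  xget u [set v | adj u v /\ class_of v = j].

Lemma class_ofE u v : class_of u = class_of v -> qpi u = qpi v.
Proof. exact: (can_inj ciK). Qed.

Lemma class_of_shift n u : class_of (shift n u) = class_of u.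
Proof. by congr ci; apply/esym/eqP/qpi_eqP; exists n. Qed.

Lemma qedgeC i j : qedge i j -> qedge j i.
Proof.
move=> /asboolP[e [ei ej]]; apply/asboolP; exists (qrev e).
by rewrite qrev_src qrev_tgt.
Qed.

Lemma qedge_irr i : ~~ qedge i i.
Proof.
apply/asboolPn => -[e [ei ej]].
by apply: (quotient_no_loop hG (e := e)); rewrite ei ej.
Qed.

Lemma adj_qedge u v : adj u v -> qedge (class_of u) (class_of v).
Proof.
move=> uv; apply/asboolP; exists (adj_qarc uv).
by rewrite adj_qarc_src adj_qarc_tgt /class_of !ciK.
Qed.

(** Both arcs project to the same quotient arc, as there are no multiple ones; the translation
    relating them fixes [u] and is trivial by freeness. *)
Lemma adj_class_inj u v v' : adj u v -> adj u v' -> class_of v = class_of v' ->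
  v = v'.
Proof.
move=> uv uv' /class_ofE vv'.
have : adj_qarc uv = adj_qarc uv'.
  by apply: (quotient_no_multiple hG); rewrite ?adj_qarc_src ?adj_qarc_tgt.
move=> /eqmodP/asboolP[n [/= nu nv]].
by move: nv; rewrite (shift_free nu) shift0.
Qed.

Lemma nbrP u j : qedge (class_of u) j ->
  adj u (nbr u j) /\ class_of (nbr u j) = j.
Proof.
move=> /asboolP[e [es et]]; rewrite /nbr; case: xgetP => [v _ //|].
have /eqP/qpi_eqP[n nu] : qpi (arc_src (repr e)) = qpi u.
  by move: es; rewrite /qsrc /class_of ciK.
move=> /(_ (shift n (arc_tgt (repr e)))) []; split.
  by rewrite -nu shift_adj qarc_adj.
by rewrite class_of_shift -[j]qvK -et.
Qed.

Lemma nbr_inj u v j : class_of u = class_of v -> qedge (class_of u) j ->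
  nbr u j = nbr v j -> u = v.
Proof.
move=> uv e; have [au _] := nbrP e; rewrite uv in e; have [av _] := nbrP e.
move=> nE; apply: (adj_class_inj (adjC au)) => //; rewrite nE; exact: adjC.
Qed.

Lemma adjacencyE (f : G -> R[i]) u : adjacency f u =
  \sum_(j < N) (if qedge (class_of u) j then f (nbr u j) else 0).
Proof.
pose s := [seq nbr u j | j <- enum [pred j | qedge (class_of u) j]].
have us : uniq s.
  rewrite map_inj_in_uniq ?enum_uniq// => i j.
  rewrite !mem_enum => ei ej nE.
  by have [_ <-] := nbrP ei; have [_ <-] := nbrP ej; rewrite nE.
rewrite /adjacency (_ : [set v | adj u v] = [set` s]); last first.
  apply/seteqP; split=> v /=.
    move=> uv; apply/mapP; exists (class_of v).
      by rewrite mem_enum; exact: adj_qedge.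
    have [uw wv] := nbrP (adj_qedge uv).
    by apply: (adj_class_inj uv uw).
  by move=> /mapP[j]; rewrite mem_enum => ej ->; have [] := nbrP ej.
by rewrite -fsbig_seq// big_map big_enum/= big_mkcond.
Qed.

Lemma schrodinger_split (Q : G -> R) (f : G -> R[i]) u :
  schrodinger Q f u =
  ((\sum_(j < N)
      (if qedge (class_of u) j then complex.Re (f (nbr u j)) else 0)
    + Q u * complex.Re (f u)) +i*
   (\sum_(j < N)
      (if qedge (class_of u) j then complex.Im (f (nbr u j)) else 0)
    + Q u * complex.Im (f u))).
Proof.
rewrite /schrodinger adjacencyE.
rewrite (_ : \sum_j _ =
  ((\sum_(j < N)
      (if qedge (class_of u) j then complex.Re (f (nbr u j)) else 0)) +i*
   (\sum_(j < N)
      (if qedge (class_of u) j then complex.Im (f (nbr u j)) else 0)))).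
  case: (f u) => x y; apply/eqP.
  by rewrite eq_complex /= !mul0r subr0 addr0 !eqxx.
elim/big_ind3: _ => // [x1 x2 x3 y1 y2 y3 -> ->//|j _].
by case: ifP => // _; case: (f _).
Qed.

Variables (kept : rel 'I_N) (phi : qvertex G -> 'rV[int]_d).
Hypothesis phiP : forall e : qarc G, kept (ci (qsrc e)) (ci (qtgt e)) ->
  qarc_index e = phi (qtgt e) - phi (qsrc e).

(** Label of the copy containing [u] once each class of the fundamental domain is displaced by
    [phi]. *)
Definition fiber (u : G) : 'rV[int]_d := cell u - phi (qpi u).

Definition fiber_point (u : G) (j : 'I_N) : G :=
  shift (fiber u - fiber (repr (qv j))) (repr (qv j)).

Lemma fiber_shift n u : fiber (shift n u) = fiber u + n.
Proof.
rewrite /fiber cell_shift addrAC; congr (_ - phi _ + _).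
by apply/esym/eqP/qpi_eqP; exists n.
Qed.

Lemma fiber_point_class u j : class_of (fiber_point u j) = j.
Proof. by rewrite class_of_shift /class_of /qpi reprK qvK. Qed.

Lemma fiber_point_fiber u j : fiber (fiber_point u j) = fiber u.
Proof. by rewrite fiber_shift addrC subrK. Qed.

Lemma fiber_inj u v : class_of u = class_of v -> fiber u = fiber v -> u = v.
Proof.
move=> /class_ofE/eqP/qpi_eqP[n <-]; rewrite fiber_shift => /eqP.
by rewrite addrC -subr_eq subrr => /eqP <-; rewrite shift0.
Qed.

Lemma fiber_pointK u i j : fiber_point (fiber_point u i) j = fiber_point u j.
Proof.
by apply: fiber_inj; rewrite ?fiber_point_class ?fiber_point_fiber.
Qed.

Lemma fiber_point_id u : fiber_point u (class_of u) = u.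
Proof. by apply: fiber_inj; rewrite ?fiber_point_class ?fiber_point_fiber. Qed.

(** Along a kept arc the change of [cell] equals that of [phi], so [fiber] is constant. *)
Lemma kept_nbr u j : qedge (class_of u) j -> kept (class_of u) j ->
  nbr u j = fiber_point u j.
Proof.
move=> e k; have [uv vj] := nbrP e.
apply: fiber_inj; rewrite ?fiber_point_class ?fiber_point_fiber//.
have := @phiP (adj_qarc uv); rewrite adj_qarc_src adj_qarc_tgt.
rewrite -/(class_of u) -/(class_of (nbr u j)) vj adj_qarc_index => /(_ k) iE.
rewrite /fiber -[cell (nbr u j)](subrK (cell u)) iE.
by rewrite addrAC [phi _ - _ - _]addrAC subrr add0r addrC.
Qed.

End Coordinates.

(** * The spectrum *)

Section LevelWeights.
Variable R : realType.
Implicit Types (mu s : R) (om a b : nat).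

(** The square root realizes the power (om + 1) / 2, a half-integer for even [om]. *)
Definition level_weight mu s om a : R :=
  Num.min (mu ^+ a) (s * Num.sqrt (mu ^+ om.+1)).

Lemma mixed_weight_ge mu s om a : 1 <= mu -> 0 < s -> (om <= (a + a).+1)%N ->
  s * mu ^+ om <= mu ^+ a * (s * Num.sqrt (mu ^+ om.+1)).
Proof.
move=> mu1 s0 oma; have mu0 : 0 < mu by apply: lt_le_trans mu1.
rewrite mulrCA ler_pM2l//.
rewrite -(@ler_pXn2r _ 2) ?nnegrE ?mulr_ge0 ?exprn_ge0 ?sqrtr_ge0 ?(ltW mu0)//.
rewrite exprMn sqr_sqrtr ?exprn_ge0 ?(ltW mu0)// -!exprM -exprD ler_weXn2l//.
by rewrite !muln2 -!addnn addnS -addSn leq_add2r.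
Qed.

(** Four cases, by which term attains each minimum. Two powers use [om <= a + b]; a power and a cap
    use [om <= 2a + 1] or [om <= 2b + 1], as [a] and [b] differ by at most 1; two caps give
    [s * mu ^+ om] times [s * mu]. *)
Lemma level_weight_ge mu s om a b : 1 <= mu -> 0 < s -> s <= 1 -> 1 <= s * mu ->
  (om <= a + b)%N -> (a <= b.+1)%N -> (b <= a.+1)%N ->
  s * mu ^+ om <= level_weight mu s om a * level_weight mu s om b.
Proof.
rewrite /level_weight; set B := s * Num.sqrt _.
move=> mu1 s0 s1 smu omab ab ba; have mu0 : 0 < mu by apply: lt_le_trans mu1.
have oma : (om <= (a + a).+1)%N by rewrite -addnS (leq_trans omab)// leq_add2l.
have omb : (om <= (b + b).+1)%N by rewrite -addSn (leq_trans omab)// leq_add2r.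
case: (leP (mu ^+ a) B) => _; case: (leP (mu ^+ b) B) => _.
- rewrite -exprD; apply: (@le_trans _ _ (1 * mu ^+ om)).
    by rewrite ler_wpM2r// exprn_ge0// ltW.
  by rewrite mul1r ler_weXn2l.
- exact: mixed_weight_ge.
- by rewrite [leRHS]mulrC; exact: mixed_weight_ge.
- have -> : B * B = (s * mu ^+ om) * (s * mu).
    rewrite mulrACA -expr2 -[X in _ * X]expr2 sqr_sqrtr ?exprn_ge0 ?(ltW mu0)//.
    by rewrite expr2 [mu ^+ _.+1]exprSr mulrACA.
  by rewrite ler_peMr// mulr_ge0 ?exprn_ge0// ltW.
Qed.

End LevelWeights.

(** * Measure of a set covered by finitely many intervals *)

Section Covering.
Variable R : realType.

(* [lebesgue_measure] is an outer measure on all sets, so that no measurability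
   is needed, in contrast with [le_measure]. *)
Lemma lebesgue_measure_mono (A B : set R) : A `<=` B ->
  (lebesgue_measure A <= lebesgue_measure B)%E.
Proof.
rewrite /lebesgue_measure/= /lebesgue_stieltjes_measure/= /measure_extension/=.
exact: (@le_mu_ext _ (ocitv_type R) R (wlength idfun) A B).
Qed.

Lemma lebesgue_measure_intervals_le (X : set R) (s : seq R) (r : R) : 0 <= r ->
  (forall x, X x -> exists2 y, y \in s & `|y - x| < r) ->
  (lebesgue_measure X <= ((size s)%:R * (2 * r))%:E)%E.
Proof.
move=> r0 Xs.
pose U (t : seq R) : set R := \big[setU/set0]_(y <- t) `]y - r, y + r[%classic.
have mU t : measurable (U t).
  by apply: bigsetU_measurable => y _; exact: measurable_itv.
apply: (@le_trans _ _ (lebesgue_measure (U s))).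
  apply: lebesgue_measure_mono => x /Xs[y ys yx].
  rewrite /U (big_rem y)//=; left; rewrite /= in_itv/=.
  by move: yx; rewrite distrC ltr_distl.
elim: s {Xs} => [|y s IHs].
  by rewrite /U big_nil measure0 mul0r.
rewrite /U big_cons -/(U s).
have mI := measurable_itv `]y - r, y + r[.
apply: (le_trans (measureU2 lebesgue_measure mI (mU s))).
have -> : ((size (y :: s))%:R * (2 * r))%:E
    = ((2 * r)%:E + ((size s)%:R * (2 * r))%:E)%E.
  by rewrite -EFinD /= -addn1 natrD mulrDl mul1r addrC.
apply: leeD => //.
have := lebesgue_measure_itv `]y - r, y + r[; rewrite /= => E; rewrite E {E}.
case: ifP => _.
  by rewrite -EFinD lee_fin; lra.
by rewrite lee_fin mulr_ge0.
Qed.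

End Covering.

(** * Points outside the spectrum, far from all levels or near one *)

Section Resolvent.
Context (R : realType) (d : nat) (G : zd_graph R d).
Hypothesis hG : periodic_graph G.
Variable Q : G -> R.
Hypothesis perQ : periodic_potential Q.
Variables (N : nat) (qv : 'I_N -> qvertex G) (ci : qvertex G -> 'I_N).
Hypotheses (ciK : cancel ci qv) (qvK : cancel qv ci).

Let q i := qpotential Q (qv i).

Let qE u : Q u = q (class_of ci u).
Proof. by rewrite /q /class_of ciK qpotential_pi. Qed.

Section Gauged.
Variables (kept : rel 'I_N) (phi : qvertex G -> 'rV[int]_d).
Hypothesis phiP : forall e : qarc G, kept (ci (qsrc e)) (ci (qtgt e)) ->
  qarc_index e = phi (qtgt e) - phi (qsrc e).

Lemma gauged_not_in_spectrum (mu lam : R) (w : 'I_N -> R) (rho eps : R) :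
  let S := fiber_mx (qedge qv) kept (fun i => mu * q i) - lam%:M in
  S \in unitmx ->
  (forall i, 0 < w i) ->
  (forall i j, w i * `|invmx S i j| * w j <= rho) ->
  (forall i j, qedge qv i j -> ~~ kept i j -> 1 <= eps * (w i * w j)) ->
  0 <= rho -> 0 <= eps -> N%:R ^+ 3 * (rho * eps) <= 2^-1 ->
  ~ real_spectrum (schrodinger (fun v : G => mu * Q v)) lam.
Proof.
move=> S Su w0 rb remw rho0 eps0 small.
apply: (@fibered_not_in_spectrum R G N (class_of ci) (qedge qv) kept
  (nbr ci) (fiber_point qv phi) _ _ _ _ _ _ (fun i => mu * q i) lam w rho eps)
  => //.
- exact: fiber_point_class.
- exact: fiber_pointK.
- exact: fiber_point_id.
- move=> u j; exact: kept_nbr.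
- by move=> u j /(nbrP ciK qvK) [].
- move=> u v j; exact: nbr_inj.
- have -> : N%:R ^+ 3 * rho ^+ 2 * (N%:R ^+ 3 * eps ^+ 2)
    = (N%:R ^+ 3 * (rho * eps)) ^+ 2 by ring.
  have -> : (4^-1 : R) = 2^-1 ^+ 2 by field.
  by rewrite lerXn2r ?nnegrE ?mulr_ge0 ?exprn_ge0 ?invr_ge0.
- by move=> f v; rewrite (schrodinger_split hG ciK qvK) qE.
Qed.

End Gauged.

(** All edges are removed and all weights are 1. The kept part is diagonal with inverse bounded by
    [B^-1], and [B >= 2 * N ^+ 3] yields the contraction. *)
Lemma far_not_in_spectrum (mu lam : R) :
  (forall i, 1 + 2 * N%:R ^+ 3 <= `|mu * q i - lam|) ->
  ~ real_spectrum (schrodinger (fun v : G => mu * Q v)) lam.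
Proof.
set B := 1 + _ => far.
have B0 : 0 < B by rewrite ltr_pwDl// mulr_ge0// exprn_ge0.
have far0 i : mu * q i - lam != 0 by rewrite -normr_gt0 (lt_le_trans B0).
pose kept : rel 'I_N := fun _ _ => false.
pose D' : 'rV[R]_N := \row_i (mu * q i - lam)^-1.
pose S := fiber_mx (qedge qv) kept (fun i => mu * q i) - lam%:M.
have SE : S = diag_mx (\row_i (mu * q i - lam)).
  apply/matrixP => i j; rewrite !mxE andbF add0r.
  by case: eqP => _; rewrite ?mulr1n ?mulr0n ?subr0.
have SD : S *m diag_mx D' = 1%:M.
  rewrite SE mulmx_diag -diag_const_mx; congr diag_mx.
  by apply/rowP => i; rewrite !mxE divff.
have [Su invE] := mulmx1_invmx SD.
apply: (@gauged_not_in_spectrum kept (fun=> 0) _ mu lam (fun=> 1) B^-1 1) => //.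
- move=> i j; rewrite invE mul1r mulr1 !mxE.
  case: eqP => _; last by rewrite mulr0n normr0 invr_ge0 ltW.
  by rewrite mulr1n normfV lef_pV2 ?posrE ?normr_gt0.
- by move=> i j _ _; rewrite !mul1r.
- by rewrite invr_ge0 ltW.
- rewrite mulr1 ler_pdivrMr// ler_pdivlMl// /B; lra.
Qed.

(** The gap is written [c + c] because half of it is lost on replacing [mu * a] by a nearby [lam].
    The bound 1 in the minimum covers the case of a single level. *)
Lemma level_gap (a : R) : exists2 c : R, 0 < c &
  forall i, q i != a -> c + c <= `|q i - a|.
Proof.
pose m := \big[Num.min/1]_(i | q i != a) `|q i - a|.
have m0 : 0 < m.
  by apply: lt_bigmin => // i ia; rewrite normr_gt0 subr_eq0.
exists (m / 2) => [|i ia]; first by rewrite divr_gt0.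
by rewrite -splitr; exact: bigmin_le_cond.
Qed.

Lemma near_level_not_in_spectrum (j0 : 'I_N) (B0 : R) : 0 <= B0 ->
  let a := q j0 in let om := omega_level Q a in
  exists K mu0 : R, [/\ 0 < K, 1 <= mu0 &
    forall mu, mu0 <= mu -> exists ev : 'I_N -> R, forall lam,
      `|mu * a - lam| <= B0 ->
      (forall k, K * mu ^- om <= `|ev k - lam|) ->
      ~ real_spectrum (schrodinger (fun v : G => mu * Q v)) lam].
Proof.
move=> B00 a om.
have [c c0 gap] := level_gap a.
pose dist i := dist_level Q a (qv i).
pose kept : rel 'I_N := fun i j => (dist i + dist j < om)%N.
have [phi phiP] : exists phi : qvertex G -> 'rV[int]_d,
    forall e : qarc G, kept (ci (qsrc e)) (ci (qtgt e)) ->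
    qarc_index e = phi (qtgt e) - phi (qsrc e).
  have [||phi phiP] := @kept_gauge R d G hG (fun e => edge_weight Q a e < om)%N.
  - by move=> e; rewrite /edge_weight qrev_src qrev_tgt addnC.
  - move=> cyc; exact: light_cycle_index0.
  by exists phi => e; rewrite /kept /dist !ciK; exact: phiP.
have edge_dist i j : qedge qv i j -> (dist i <= (dist j).+1)%N.
  rewrite /dist => /asboolP[e [<- <-]]; apply: dist_level_lip => //.
  by exists (qv j0).
have dist0 i : (0 < dist i)%N -> q i != a.
  by apply: contraTneq => ia; rewrite /dist -ia dist_level_self.
pose n3 : R := N%:R ^+ 3.
have n30 : 0 <= n3 by rewrite exprn_ge0.
pose D := (\max_i dist i)%N.
have distD i : (dist i <= D)%N by exact: leq_bigmax.
pose L := 1 + N%:R / c.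
have Nc0 : 0 <= N%:R / c by rewrite divr_ge0// ltW.
have L0 : 0 <= L by rewrite addr_ge0.
(* [s] makes the constant error term of the decay contribute at most 1/4 to the final bound 1/2; [K]
   below does the same for the decaying term. *)
have [s [s0 s1 sc]] : exists s, [/\ 0 < s, s <= 1 & 16 * n3 * s <= c].
  have den0 : 0 < c + 16 * n3 by rewrite ltr_wpDr// mulr_ge0.
  exists (c / (c + 16 * n3)); split; first by rewrite divr_gt0.
    by rewrite ler_pdivrMr// mul1r lerDl mulr_ge0.
  rewrite mulrA ler_pdivrMr// mulrC ler_pM2l// lerDr; exact: ltW.
pose X := L ^+ (D + D) * N%:R.
have X0 : 0 <= X by rewrite mulr_ge0// exprn_ge0.
have [K [K0 KX]] : exists K, 0 < K /\ 4 * n3 * X <= K * s.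
  have nXs0 : 0 <= 4 * n3 * X / s.
    by rewrite divr_ge0 ?(ltW s0)// mulr_ge0// mulr_ge0.
  exists (1 + 4 * n3 * X / s); split; first by rewrite ltr_pwDl.
  rewrite [leRHS]mulrDl mul1r divfK ?gt_eqF// lerDr; exact: ltW.
(* The three summands ensure [1 <= mu], [1 <= s * mu] and [2 * N + B0 <= c * mu]. *)
exists K, (1 + s^-1 + (2 * N%:R + B0) / c); split=> //.
  by rewrite -addrA lerDl addr_ge0 ?invr_ge0 ?divr_ge0 ?addr_ge0 ?mulr_ge0// ltW.
move=> mu mu0.
have t1 : 0 < s^-1 by rewrite invr_gt0.
have t2 : 0 <= (2 * N%:R + B0) / c.
  by rewrite divr_ge0 ?(ltW c0)// addr_ge0// mulr_ge0.
have mu1 : 1 <= mu by lra.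
have mup : 0 < mu by lra.
have smu : 1 <= s * mu.
  rewrite mulrC -ler_pdivrMr// div1r; lra.
have cmu : 2 * N%:R + B0 <= c * mu by rewrite [leRHS]mulrC -ler_pdivrMr//; lra.
have cmu0 : 0 < c * mu by rewrite mulr_gt0.
have N0 : 0 <= 2 * N%:R :> R by rewrite mulr_ge0.
have muo : 0 < mu ^+ om by rewrite exprn_gt0.
pose M := fiber_mx (qedge qv) kept (fun i => mu * q i).
have symM : M^T = M.
  apply/matrixP => i j; rewrite !mxE eq_sym /kept [(dist j + _)%N]addnC.
  have -> : qedge qv j i = qedge qv i j by apply/idP/idP; exact: qedgeC.
  by case: eqP => [->|_].
have [ev evP] := sym_resolvent_bound symM.
exists ev => lam lama evlam.
have eps0 : 0 < K * mu ^- om by rewrite mulr_gt0// invr_gt0.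
have [Su rb] := evP lam _ eps0 evlam.
pose S := M - lam%:M.
pose w i := level_weight mu s om (dist i).
pose B := s * Num.sqrt (mu ^+ om.+1).
have B2 : B ^+ 2 = s ^+ 2 * (mu ^+ om * mu).
  by rewrite /B exprMn sqr_sqrtr ?exprn_ge0 ?(ltW mup)// [mu ^+ _.+1]exprSr.
have Bp : 0 < B by rewrite mulr_gt0// sqrtr_gt0 exprn_gt0.
have w0 i : 0 < w i by rewrite /w /level_weight lt_min exprn_gt0.
pose rho := L ^+ (D + D) * (N%:R / (K * mu ^- om)) + 4 * B ^+ 2 / (c * mu).
have rhoE : rho = mu ^+ om * (X / K + 4 * s ^+ 2 / c).
  rewrite /rho /X B2; move: (mu ^+ om) muo (L ^+ _) => y y0 l.
  by field; rewrite !gt_eqF.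
have rho0 : 0 <= rho.
  rewrite rhoE mulr_ge0 ?(ltW muo)// addr_ge0 ?divr_ge0 ?(ltW K0) ?(ltW c0)//.
  by rewrite mulr_ge0// sqr_ge0.
have offdiag i j : i != j -> S i j = (qedge qv i j && kept i j)%:R.
  by move=> ij; rewrite !mxE (negbTE ij) !mulr0n addr0 subr0.
apply: (@gauged_not_in_spectrum kept phi phiP mu lam w rho (s * mu ^+ om)^-1)
  => //.
- apply: (@weighted_inverse_entry R N S _ dist w mu c _ B L D) => //.
  + exact: mulmxV.
  + rewrite trmx_inv; congr invmx.
    by rewrite raddfB/= tr_scalar_mx -/M symM.
  (* Off the level set [mu * |q i - a|] is at least [2 * c * mu], and
     [|mu * a - lam| <= B0 <= c * mu] takes away at most half. *)
  + move=> i /dist0 /gap gi.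
    rewrite !mxE eqxx (negbTE (qedge_irr hG qv i)) /= add0r !mulr1n.
    have -> : mu * q i - lam = mu * (q i - a) + (mu * a - lam) by ring.
    apply: le_trans (lerB_normD _ _); rewrite normrM (gtr0_norm mup).
    rewrite lerBrDr; apply: le_trans (ler_wpM2l (ltW mup) gi).
    rewrite [leRHS]mulrC mulrDl lerD2l (le_trans lama)//.
    by apply: le_trans cmu; rewrite lerDr.
  + move=> i j /offdiag ->; by case: (_ && _); rewrite ?normr1 ?normr0.
  + move=> i j /offdiag ->.
    case: (boolP (qedge qv i j)) => [e _|]; last by rewrite eqxx.
    exact: edge_dist.
  + by apply: le_trans cmu; rewrite lerDl.
  + by move=> i; rewrite ltW.
  + by move=> i; rewrite ge_min lexx.
  + by move=> i; rewrite ge_min lexx orbT.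
  + by rewrite lerDl.
  + by rewrite lerDr.
- move=> i j e; rewrite -leqNgt => omij.
  rewrite ler_pdivlMl ?mulr1 ?mulr_gt0//.
  apply: level_weight_ge => //; apply: edge_dist => //; exact: qedgeC.
- by rewrite invr_ge0 mulr_ge0// ltW.
(* The powers of [mu] cancel, since [rho] is proportional to [mu ^+ om]; each remaining term is at
   most 1/4. *)
- have -> : n3 * (rho * (s * mu ^+ om)^-1)
      = (n3 * X) / (K * s) + 4 * (n3 * s) / c.
    rewrite rhoE; move: (mu ^+ om) muo (n3) (X) => y y0 n x.
    by field; rewrite !gt_eqF.
  have Ks0 : 0 < K * s by rewrite mulr_gt0.
  have h1 : n3 * X / (K * s) <= 4^-1.
    by rewrite ler_pdivrMr// ler_pdivlMl// mulrA.
  have h2 : 4 * (n3 * s) / c <= 4^-1.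
    rewrite ler_pdivrMr// ler_pdivlMl//; apply: le_trans sc.
    by move: (n3) => n; rewrite (_ : 4 * (4 * _) = 16 * n * s)//; ring.
  apply: le_trans (lerD h1 h2) _.
  by rewrite (_ : 4^-1 + 4^-1 = 2^-1)//; field.
Qed.

End Resolvent.

Theorem theorem1p3 (R : realType) (d : nat) (G : zd_graph R d)
    (hG : periodic_graph G) (Q : G -> R) (hQ : periodic_potential Q) :
  exists C : R, \forall mu \near +oo,
    (lebesgue_measure (real_spectrum (schrodinger (fun v : G => (mu * Q v)%R)))
       <= (C * mu ^- omega Q)%:E)%E.
Proof.
have [N [qv [ci [ciK qvK]]]] := qvertex_enum hG.
(* [B0] is the threshold of [far_not_in_spectrum], so the far and near cases are exhaustive. *)
pose B0 : R := 1 + 2 * N%:R ^+ 3.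
have B00 : 0 <= B0 by rewrite addr_ge0// mulr_ge0// exprn_ge0.
pose q i := qpotential Q (qv i).
have near_j (j : 'I_N) : exists p : R * R, [/\ 0 < p.1, 1 <= p.2 &
    forall mu, p.2 <= mu -> exists ev : 'I_N -> R, forall lam,
      `|mu * q j - lam| <= B0 ->
      (forall k, p.1 * mu ^- omega_level Q (q j) <= `|ev k - lam|) ->
      ~ real_spectrum (schrodinger (fun v : G => mu * Q v)) lam].
  have [K [mu0 H]] := near_level_not_in_spectrum hG hQ ciK qvK j B00.
  by exists (K, mu0).
have [p pP] := choice near_j.
(* Sums of nonnegative terms serve as common upper bounds for the constants of all classes. *)
pose K := \sum_j (p j).1; pose mu0 := 1 + \sum_j (p j).2.
have p1 j : 0 <= (p j).1 by have [/ltW] := pP j.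
have p2 j : 0 <= (p j).2 by have [_ /(le_trans ler01)] := pP j.
have pK j : (p j).1 <= K by rewrite /K (bigD1 j)//= lerDl sumr_ge0.
have pmu j : (p j).2 <= mu0.
  by rewrite /mu0 (bigD1 j)//= addrCA lerDl addr_ge0// sumr_ge0.
have K0 : 0 <= K by rewrite sumr_ge0.
have mu01 : 1 <= mu0 by rewrite lerDl sumr_ge0.
exists ((N * N)%:R * (2 * (K + 1))).
apply: filterS (nbhs_pinfty_ge (num_real mu0)) => mu mu0mu.
have mu1 : 1 <= mu by exact: le_trans mu0mu.
have mup : 0 < mu by exact: lt_le_trans mu1.
have ex_ev (j : 'I_N) : exists ev : 'I_N -> R, forall lam,
      `|mu * q j - lam| <= B0 ->
      (forall k, (p j).1 * mu ^- omega_level Q (q j) <= `|ev k - lam|) ->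
      ~ real_spectrum (schrodinger (fun v : G => mu * Q v)) lam.
  by have [_ _ H] := pP j; apply: H; exact: le_trans mu0mu.
have [ev evP] := choice ex_ev.
have omega_le j : (omega Q <= omega_level Q (q j))%N.
  have [] := @nat_minP [set omega_level Q a | a in range (qpotential Q)].
    by exists (omega_level Q (q j)); exists (q j) => //; exists (qv j).
  by move=> _; apply; exists (q j) => //; exists (qv j).
(* As [mu >= 1] and [omega Q] is the least of the [omega_level], one radius serves all levels. *)
pose r := (K + 1) * mu ^- omega Q.
have r0 : 0 <= r by rewrite mulr_ge0 ?addr_ge0// invr_ge0 exprn_ge0// ltW.
pose centers := [seq ev ij.1 ij.2 | ij : 'I_N * 'I_N].
have -> : (N * N)%:R * (2 * (K + 1)) * mu ^- omega Q
    = (size centers)%:R * (2 * r).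
  by rewrite size_map -cardE card_prod card_ord /r; ring.
apply: lebesgue_measure_intervals_le => // lam specl.
have [[j nearj]|/forallNP far] := pselect
    (exists j, `|mu * q j - lam| <= B0); last first.
  exfalso; apply: (far_not_in_spectrum hG hQ ciK qvK) specl => i.
  by have /negP := far i; rewrite -ltNge => /ltW.
have [[k kl]|/forallNP farev] := pselect
    (exists k, `|ev j k - lam| < (p j).1 * mu ^- omega_level Q (q j)); last first.
  exfalso; apply: (evP j lam nearj _ specl) => k.
  by have /negP := farev k; rewrite -leNgt.
exists (ev j k); first by apply/mapP; exists (j, k); rewrite ?mem_enum.
apply: (lt_le_trans kl); apply: ler_pM => //.
- by rewrite invr_ge0 exprn_ge0// ltW.
- by rewrite (le_trans (pK j))// lerDl.
- by rewrite lef_pV2 ?posrE ?exprn_gt0// ler_weXn2l.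
Qed.
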